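(* Let $H:\mathbb{R}^2\to\mathbb{R}$ satisfy: (a) $H\in C^{0,\alpha}(\mathbb{R}^2;\mathbb{R})$ for some $\alpha\in(0,1)$; (b) $H(p+n)=H(p)$ for all $p\in\mathbb{R}^2$, $n\in\mathbb{Z}^2$; (c) $\sup_{p\in\mathbb{R}^2}|H(p)-[H]|<2\sqrt{2}$, where $[H]=\int_{[0,1]^2}H(p)\,dp$. Then for every $\tau\in\mathbb{R}\setminus\{0\}$ there exists $(u_\tau,\lambda)\in C^2(\mathbb{R};\mathbb{R}^2)\times\mathbb{R}$ such that $\mathcal{A}(u_\tau)=\tau$, there is $T>0$ with $u_\tau(t+T)=u_\tau(t)$ for all $t\in\mathbb{R}$, and $\mathcal{K}(u_\tau)(t)=H(u_\tau(t))-\lambda$ for all $t\in\mathbb{R}$.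
   Context: Identify $\mathbb{R}^2$ with $\mathbb{C}$: for $p\in\mathbb{R}^2$, $ip$ denotes the counterclockwise rotation of $p$ by $\pi/2$, and $p\cdot q$ is the Euclidean scalar product. For $U\in C^2(\mathbb{R};\mathbb{R}^2)$ with $\dot U(t)\neq0$, its signed curvature is $\mathcal{K}(U)=\frac{i\dot U\cdot\ddot U}{|\dot U|^3}$. For a $T$-periodic map $u$, its signed area is $\mathcal{A}(u)=\frac12\int_0^T u\cdot i\dot u\,dt$. *)

(* Defs.v *)
From Stdlib Require Import Reals.
From Coquelicot Require Import Coquelicot.
Open Scope R_scope.

Definition norm2 (p : R * R) : R := sqrt (fst p ^ 2 + snd p ^ 2).

Definition holder_C0a (alpha : R) (H : R * R -> R) : Prop :=
  (exists M, forall p, Rabs (H p) <= M) /\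
  (exists C, forall p q : R * R, p <> q ->
     Rabs (H p - H q) <=
       C * Rpower (norm2 (fst p - fst q, snd p - snd q)) alpha).

Definition Z2_periodic (H : R * R -> R) : Prop :=
  forall (p : R * R) (n1 n2 : Z), H (fst p + IZR n1, snd p + IZR n2) = H p.

(* [H] = integral of H over [0,1]^2 (iterated Riemann integral; H is continuous) *)
Definition mean_H (H : R * R -> R) : R :=
  RInt (fun x => RInt (fun y => H (x, y)) 0 1) 0 1.

Definition C2 (f : R -> R) : Prop :=
  forall t, ex_derive f t /\ ex_derive (Derive f) t /\
            continuous (Derive (Derive f)) t.

Definition C2_curve (u : R -> R * R) : Prop :=
  C2 (fun t => fst (u t)) /\ C2 (fun t => snd (u t)).

Definition du1 (u : R -> R * R) (t : R) : R := Derive (fun s => fst (u s)) t.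
Definition du2 (u : R -> R * R) (t : R) : R := Derive (fun s => snd (u s)) t.
Definition ddu1 (u : R -> R * R) (t : R) : R := Derive (du1 u) t.
Definition ddu2 (u : R -> R * R) (t : R) : R := Derive (du2 u) t.

Definition rot (p : R * R) : R * R := (- snd p, fst p).
Definition dot (p q : R * R) : R := fst p * fst q + snd p * snd q.

Definition curvature (u : R -> R * R) (t : R) : R :=
  dot (rot (du1 u t, du2 u t)) (ddu1 u t, ddu2 u t) / (norm2 (du1 u t, du2 u t)) ^ 3.

Definition area (T : R) (u : R -> R * R) : R :=
  / 2 * RInt (fun t => dot (u t) (rot (du1 u t, du2 u t))) 0 T.

(* Main.v *)
(** Subtracting the mean from [H] costs only a shift of [lambda], so let [g = H - [H]]. Since [g]
    has mean zero and [|g| <= c < 2 sqrt 2], it is the divergence of a periodic field [(P, Q)] of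
    length at most [sqrt 2 * c / 4 < 1]. Hence [length - int (P dy - Q dx)] is coercive, and it is
    invariant under integer translations; a critical point at prescribed area [tau] is a loop of
    curvature [g - lambda], [lambda] being the Lagrange multiplier.

    Minimising over closed [N]-gons makes compactness finite-dimensional: the length is replaced by
    the square root of [N * sum |v_(i+1) - v_i|^2] and the flux by a quadrature sum. The discrete
    Euler-Lagrange equations bound the difference quotients of first and second order independently
    of [N], and only involve [P] and [Q] through their divergence, up to an error tending to zero.
    As [N] tends to infinity along an ultrafilter, the polygons converge to a solution of
    [u'' = l (g(u) - lambda) i u'] with constant speed [l]. *)

Require Import Defs.
From Stdlib Require Import Reals Lra Lia ZArith Classical ClassicalChoice FunctionalExtensionality.
From Coquelicot Require Import Coquelicot.
From mathcomp.classical Require filter.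
Open Scope R_scope.

(** * Limits along ultrafilters *)

(** Inverting [d/dx] or [d/dy] on mean-zero periodic functions costs a factor 1/4 in sup norm, and
    [sqrt 2] combines the two components of the field; [2 sqrt 2] is the value of [c] at which the
    resulting bound reaches 1.

    As [g] is merely continuous, the field is built with divergence only close to [g], and it
    changes with the tolerance. Its sup norm stays bounded, but nothing controls its partial
    derivatives as the tolerance shrinks, so no estimate may involve them. This is why the flux is
    discretised by central differences: these are antisymmetric under summation by parts, and the
    uncontrolled terms cancel in the first variation. The order of choices is tolerance, then field,
    then [N].

    The square root of the energy replaces the length because it stays differentiable when single
    edges collapse, and because its Euler-Lagrange equation also fixes the parametrisation: the
    limit has constant speed. The area is homogeneous of degree two, so that testing with the
    dilation computes the multiplier and bounds it. *)

Lemma ultrafilter_nat_exists :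
  exists U : (nat -> Prop) -> Prop,
    ProperFilter U /\
    (forall P, U P \/ U (fun n => ~ P n)) /\
    (forall P, eventually P -> U P).
Proof.
  (* [filter.ProperFilter] is the MathComp class, whose ultrafilter lemma extends the cofinite
     filter; the result is then repackaged for the Coquelicot class [ProperFilter]. *)
  assert (Hev : @filter.ProperFilter nat eventually).
  { split.
    - intros [N HN]. exact (HN N (le_n N)).
    - split.
      + exists 0%nat. intros; exact I.
      + intros P Q HP HQ. exact (filter_and P Q HP HQ).
      + intros P Q HPQ HP. exact (filter_imp P Q HPQ HP). }
  destruct (@filter.ultraFilterLemma nat eventually Hev) as [U [HU HevU]].
  assert (HP := @filter.ultra_proper nat U HU).
  exists U. split; [|split].
  - split.
    + intros P HPU. exact (@filter.filter_ex nat U HP P HPU).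
    + split.
      * exact (@filter.filterT nat U (@filter.filter_filter nat U HP)).
      * intros P Q. exact (@filter.filterI nat U (@filter.filter_filter nat U HP) P Q).
      * intros P Q. exact (@filter.filterS nat U (@filter.filter_filter nat U HP) P Q).
  - intros P. exact (@filter.in_ultra_setVsetC nat U P HU).
  - exact HevU.
Qed.

(** The limit is the supremum of the reals lying below [f n] for [U]-almost every [n]; the
    ultrafilter property turns failure of such a lower bound into an upper bound. One [U] serves all
    sequences at once, so no subsequences are extracted. *)
Lemma ultralimit_bounded_exists (U : (nat -> Prop) -> Prop) (f : nat -> R) (B : R) :
  ProperFilter U -> (forall P, U P \/ U (fun n => ~ P n)) ->
  U (fun n => Rabs (f n) <= B) -> exists l : R, filterlim f U (locally l).
Proof.
  intros HU ultra HB.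
  set (E := fun x => U (fun n => x <= f n)).
  destruct (completeness E) as [l [Hl1 Hl2]].
  - exists B. intros x Hx. change (U (fun n => x <= f n)) in Hx.
    destruct (filter_ex _ (filter_and _ _ Hx HB)) as [n [H1 H2]].
    apply Rabs_le_between in H2; lra.
  - exists (- B). change (U (fun n => - B <= f n)). revert HB. apply filter_imp. intros n H2.
    apply Rabs_le_between in H2; lra.
  - exists l. apply filterlim_locally. intros [eps Heps].
    assert (Hlow : U (fun n => l - eps / 2 <= f n)).
    { destruct (ultra (fun n => l - eps / 2 <= f n)) as [h|h]; [exact h|].
      exfalso. assert (l <= l - eps / 2); [|lra].
      apply Hl2. intros x Hx. change (U (fun n => x <= f n)) in Hx. apply Rnot_lt_le. intros Hlt.
      destruct (filter_ex _ (filter_and _ _ Hx h)) as [n [H1 H2]]. lra. }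
    assert (Hup : U (fun n => ~ l + eps / 2 <= f n)).
    { destruct (ultra (fun n => l + eps / 2 <= f n)) as [h|h]; [|exact h].
      exfalso. assert (l + eps / 2 <= l); [|lra]. apply Hl1. exact h. }
    generalize (filter_and _ _ Hlow Hup). apply filter_imp. intros n [H1 H2].
    apply Rnot_le_lt in H2. unfold ball; simpl; unfold AbsRing_ball, abs, minus, plus, opp; simpl.
    apply Rabs_def1; lra.
Qed.

Section FilterLim.
Context {T : Type} {F : (T -> Prop) -> Prop} {FF : Filter F}.

Lemma filterlim_Rplus (f g : T -> R) (a b : R) :
  filterlim f F (locally a) -> filterlim g F (locally b) ->
  filterlim (fun n => f n + g n) F (locally (a + b)).
Proof. intros Hf Hg. exact (filterlim_comp_2 f g _ Hf Hg (filterlim_plus a b)). Qed.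

Lemma filterlim_Rmult (f g : T -> R) (a b : R) :
  filterlim f F (locally a) -> filterlim g F (locally b) ->
  filterlim (fun n => f n * g n) F (locally (a * b)).
Proof. intros Hf Hg. exact (filterlim_comp_2 f g _ Hf Hg (filterlim_mult a b)). Qed.

Lemma filterlim_Ropp (f : T -> R) (a : R) :
  filterlim f F (locally a) -> filterlim (fun n => - f n) F (locally (- a)).
Proof. intros Hf. eapply filterlim_comp; [exact Hf|]. apply (filterlim_opp a). Qed.

Lemma filterlim_Rminus (f g : T -> R) (a b : R) :
  filterlim f F (locally a) -> filterlim g F (locally b) ->
  filterlim (fun n => f n - g n) F (locally (a - b)).
Proof. intros Hf Hg. apply filterlim_Rplus; [exact Hf|]. now apply filterlim_Ropp. Qed.

Lemma filterlim_Rabs_le (f : T -> R) (l : R) :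
  (forall eps, 0 < eps -> F (fun n => Rabs (f n - l) <= eps)) ->
  filterlim f F (locally l).
Proof.
  intros Hf. apply filterlim_locally. intros [eps Heps].
  generalize (Hf (eps / 2) ltac:(lra)). apply filter_imp. intros n Hn.
  unfold ball; simpl; unfold AbsRing_ball, abs, minus, plus, opp; simpl.
  change (Rabs (f n - l) < eps). lra.
Qed.

Lemma filterlim_Rabs_lt (f : T -> R) (l eps : R) :
  filterlim f F (locally l) -> 0 < eps -> F (fun n => Rabs (f n - l) < eps).
Proof.
  intros Hf Heps. exact (proj1 (filterlim_locally f l) Hf (mkposreal eps Heps)).
Qed.

End FilterLim.

Lemma filterlim_Rle {T : Type} {F : (T -> Prop) -> Prop} {FF : ProperFilter F}
  (f g : T -> R) (a b : R) :
  F (fun n => f n <= g n) -> filterlim f F (locally a) ->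
  filterlim g F (locally b) -> a <= b.
Proof.
  intros Hfg Hf Hg. apply Rnot_lt_le. intros Hlt.
  assert (H1 := filterlim_Rabs_lt f a ((a - b) / 2) Hf ltac:(lra)).
  assert (H2 := filterlim_Rabs_lt g b ((a - b) / 2) Hg ltac:(lra)).
  destruct (filter_ex _ (filter_and _ _ Hfg (filter_and _ _ H1 H2))) as [n [H3 [H4 H5]]].
  apply Rabs_def2 in H4. apply Rabs_def2 in H5. lra.
Qed.

Lemma filterlim_Runique {T : Type} {F : (T -> Prop) -> Prop} {FF : ProperFilter F}
  (f : T -> R) (a b : R) :
  filterlim f F (locally a) -> filterlim f F (locally b) -> a = b.
Proof.
  intros Ha Hb. apply Rle_antisym; eapply filterlim_Rle; eauto;
  apply filter_forall; intros; apply Rle_refl.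
Qed.

(** * Rescaled sequences *)

Section Rescaling.
Context {U : (nat -> Prop) -> Prop} {HU : ProperFilter U}.
Variable N : nat -> nat.
Hypothesis N_infty : forall K, U (fun n => K <= INR (N n)).

(* Convergence of [(n, i)] as [n] tends to infinity along [U] and [i / N n] to [s]. *)
Definition node_filter (s : R) (P : nat * Z -> Prop) : Prop :=
  exists d, 0 < d /\
    U (fun n => forall i, Rabs (IZR i - s * INR (N n)) <= d * INR (N n) -> P (n, i)).

Definition node (t : R) (n : nat) : Z := Int_part (t * INR (N n)).

Lemma node_bounds (t : R) (n : nat) :
  t * INR (N n) - 1 < IZR (node t n) <= t * INR (N n).
Proof. unfold node. destruct (base_Int_part (t * INR (N n))). lra. Qed.

Lemma N_ge_1 : U (fun n => 1 <= INR (N n)).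
Proof. apply N_infty. Qed.

Global Instance node_filter_proper (s : R) : ProperFilter (node_filter s).
Proof.
  split.
  - intros P [d [Hd HP]].
    (* Properness requires an integer in the window: once [d * INR (N n) >= 1], the rounding error
       of [node s n] fits. *)
    destruct (filter_ex _ (filter_and _ _ HP (N_infty (1 / d)))) as [n [H1 H2]].
    exists (n, node s n). apply H1.
    assert (Hb := node_bounds s n). apply Rle_trans with 1.
    + apply Rabs_le. lra.
    + apply (Rmult_le_compat_l d) in H2; [|lra].
      replace (d * (1 / d)) with 1 in H2 by (field; lra). exact H2.
  - split.
    + exists 1. split; [lra|]. apply filter_forall. auto.
    + intros P Q [d [Hd HP]] [e [He HQ]]. exists (Rmin d e). split.
      * apply Rmin_glb_lt; lra.
      * generalize (filter_and _ _ HP HQ). apply filter_imp.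
        intros n [H1 H2] i Hi. assert (H0 := pos_INR (N n)).
        split; [apply H1|apply H2]; eapply Rle_trans; try exact Hi;
        apply Rmult_le_compat_r; auto using Rmin_l, Rmin_r.
    + intros P Q HPQ [d [Hd HP]]. exists d. split; [exact Hd|].
      revert HP. apply filter_imp. auto.
Qed.

Lemma node_filter_fst (s : R) (P : nat -> Prop) :
  U P -> node_filter s (fun z => P (fst z)).
Proof.
  intros HP. exists 1. split; [lra|]. revert HP. apply filter_imp. auto.
Qed.

Lemma filterlim_fst_node (s : R) (f : nat -> R) (l : R) :
  filterlim f U (locally l) -> filterlim (fun z => f (fst z)) (node_filter s) (locally l).
Proof.
  intros Hf. apply filterlim_Rabs_le. intros eps Heps.
  apply (node_filter_fst s (fun n => Rabs (f n - l) <= eps)).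
  generalize (filterlim_Rabs_lt f l eps Hf Heps). apply filter_imp. intros; lra.
Qed.

Lemma filterlim_shift_node (s : R) (f : nat -> Z -> R) (l : R) :
  filterlim (fun z => f (fst z) (snd z)) (node_filter s) (locally l) ->
  filterlim (fun z => f (fst z) (snd z + 1)%Z) (node_filter s) (locally l).
Proof.
  intros Hf. apply filterlim_Rabs_le. intros eps Heps.
  destruct (filterlim_Rabs_lt _ _ _ Hf Heps) as [d [Hd H1]].
  exists (d / 2). split; [lra|].
  generalize (filter_and _ _ H1 (N_infty (2 / d))). apply filter_imp.
  intros n [H2 H3] i Hi. simpl. apply Rlt_le. apply (H2 (i + 1)%Z).
  rewrite plus_IZR.
  apply (Rmult_le_compat_l (d / 2)) in H3; [|lra].
  replace (d / 2 * (2 / d)) with 1 in H3 by (field; lra).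
  apply Rabs_le_between in Hi. apply Rabs_le. lra.
Qed.

Lemma increments_le (f : Z -> R) (G e : R) (i : Z) (k : nat) :
  (forall j, (i <= j < i + Z.of_nat k)%Z -> Rabs (f (j + 1)%Z - f j - G) <= e) ->
  Rabs (f (i + Z.of_nat k)%Z - f i - G * INR k) <= e * INR k.
Proof.
  induction k as [|k IH]; intros Hj.
  - simpl. rewrite Z.add_0_r. rewrite Rabs_pos_eq; lra.
  - rewrite S_INR. assert (H1 := Hj (i + Z.of_nat k)%Z ltac:(lia)).
    assert (H2 : Rabs (f (i + Z.of_nat k)%Z - f i - G * INR k) <= e * INR k)
      by (apply IH; intros; apply Hj; lia).
    replace (i + Z.of_nat (S k))%Z with (i + Z.of_nat k + 1)%Z by lia.
    apply Rabs_le_between in H1. apply Rabs_le_between in H2. apply Rabs_le. lra.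
Qed.

(** Telescoping, with the indices in either order because nodes are compared on both sides of a base
    point. *)
Lemma increments_abs_le (f : Z -> R) (G e : R) (i j : Z) :
  (forall k, (Z.min i j <= k < Z.max i j)%Z -> Rabs (f (k + 1)%Z - f k - G) <= e) ->
  Rabs (f j - f i - G * (IZR j - IZR i)) <= e * Rabs (IZR j - IZR i).
Proof.
  intros Hk. destruct (Z_le_gt_dec i j) as [Hij|Hij].
  - assert (H := increments_le f G e i (Z.to_nat (j - i)) ltac:(intros; apply Hk; lia)).
    rewrite INR_IZR_INZ, Z2Nat.id in H by lia.
    replace (i + (j - i))%Z with j in H by lia. rewrite minus_IZR in H.
    assert (IZR i <= IZR j) by (apply IZR_le; lia).
    rewrite (Rabs_pos_eq (IZR j - IZR i)) by lra. exact H.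
  - assert (H := increments_le f G e j (Z.to_nat (i - j)) ltac:(intros; apply Hk; lia)).
    rewrite INR_IZR_INZ, Z2Nat.id in H by lia.
    replace (j + (i - j))%Z with i in H by lia. rewrite minus_IZR in H.
    assert (IZR j <= IZR i) by (apply IZR_le; lia).
    rewrite (Rabs_left1 (IZR j - IZR i)) by lra. rewrite <- Rabs_Ropp.
    replace (- (f j - f i - G * (IZR j - IZR i))) with (f i - f j - G * (IZR i - IZR j)) by ring.
    replace (- (IZR j - IZR i)) with (IZR i - IZR j) by ring. exact H.
Qed.

Lemma filterlim_node_ratio (t : R) :
  filterlim (fun n => IZR (node t n) / INR (N n)) U (locally t).
Proof.
  apply filterlim_Rabs_le. intros eps Heps.
  generalize (filter_and _ _ N_ge_1 (N_infty (1 / eps))). apply filter_imp.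
  intros n [H1 H2]. assert (Hb := node_bounds t n).
  replace (IZR (node t n) / INR (N n) - t) with ((IZR (node t n) - t * INR (N n)) / INR (N n))
    by (field; lra).
  unfold Rdiv. rewrite Rabs_mult, (Rabs_pos_eq (/ INR (N n))).
  2: { apply Rlt_le, Rinv_0_lt_compat; lra. }
  apply (Rmult_le_reg_r (INR (N n))); [lra|].
  rewrite Rmult_assoc, Rinv_l, Rmult_1_r by lra.
  apply Rle_trans with 1; [apply Rabs_le; lra|].
  apply (Rmult_le_compat_l eps) in H2; [|lra].
  replace (eps * (1 / eps)) with 1 in H2 by (field; lra). exact H2.
Qed.

Section Function.
Variables (f : nat -> Z -> R) (phi : R -> R).
Hypothesis f_lim : forall t, filterlim (fun n => f n (node t n)) U (locally (phi t)).

(** Convergence along the single index [node s n] spreads to a whole window of indices, over which a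
    uniform bound on the difference quotients lets [f n] move only a little. *)
Lemma filterlim_node_of_lipschitz (C s : R) :
  U (fun n => forall i, Rabs (INR (N n) * (f n (i + 1)%Z - f n i)) <= C) ->
  filterlim (fun z => f (fst z) (snd z)) (node_filter s) (locally (phi s)).
Proof.
  intros HC. apply filterlim_Rabs_le. intros eps Heps.
  assert (HC1 : 0 < Rabs C + 1) by (assert (H := Rabs_pos C); lra).
  (* The window contributes at most [2 * d * Rabs C <= eps / 2]; convergence at [node s n] pays the
     other half. *)
  set (d := eps / (4 * (Rabs C + 1))).
  assert (Hd : 0 < d) by (apply Rdiv_lt_0_compat; lra).
  exists d. split; [exact Hd|].
  generalize (filter_and _ _ HC (filter_and _ _ (N_infty (1 / d + 1))
     (filterlim_Rabs_lt _ _ (eps / 2) (f_lim s) ltac:(lra)))).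
  apply filter_imp. intros n [H1 [H2 H3]] i Hi. simpl.
  assert (Hd1 : 0 < 1 / d) by (apply Rdiv_lt_0_compat; lra).
  assert (HN : 0 < INR (N n)) by lra.
  assert (Hb := node_bounds s n).
  assert (H4 : Rabs (f n i - f n (node s n) - 0 * (IZR i - IZR (node s n)))
     <= C / INR (N n) * Rabs (IZR i - IZR (node s n))).
  { apply increments_abs_le. intros k _. rewrite Rminus_0_r.
    specialize (H1 k). rewrite Rabs_mult, (Rabs_pos_eq (INR (N n))) in H1 by lra.
    apply (Rmult_le_reg_l (INR (N n))); [exact HN|].
    replace (INR (N n) * (C / INR (N n))) with C by (field; lra). exact H1. }
  rewrite Rmult_0_l, Rminus_0_r in H4.
  assert (H5 : Rabs (IZR i - IZR (node s n)) <= 2 * d * INR (N n)).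
  { assert (1 <= d * INR (N n)).
    { apply Rle_trans with (d * (1 / d)); [right; field; lra|].
      apply Rmult_le_compat_l; lra. }
    apply Rabs_le_between in Hi. apply Rabs_le. lra. }
  assert (H6 : C / INR (N n) * Rabs (IZR i - IZR (node s n)) <= Rabs C * (2 * d)).
  { apply Rle_trans with (Rabs C / INR (N n) * Rabs (IZR i - IZR (node s n))).
    - apply Rmult_le_compat_r; [apply Rabs_pos|].
      apply Rmult_le_compat_r; [apply Rlt_le, Rinv_0_lt_compat; lra|apply Rle_abs].
    - apply Rle_trans with (Rabs C / INR (N n) * (2 * d * INR (N n))).
      + apply Rmult_le_compat_l; [|exact H5].
        apply Rmult_le_pos; [apply Rabs_pos|apply Rlt_le, Rinv_0_lt_compat; lra].
      + right; field; lra. }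
  assert (H7 : Rabs C * (2 * d) <= eps / 2).
  { replace (eps / 2) with ((Rabs C + 1) * (2 * d)) by (unfold d; field; lra).
    apply Rmult_le_compat_r; lra. }
  replace (f n i - phi s) with ((f n i - f n (node s n)) + (f n (node s n) - phi s)) by ring.
  eapply Rle_trans; [apply Rabs_triang|]. lra.
Qed.

(** Near [s] all rescaled increments are within [eps] of [G]; summing those between the nodes of [s]
    and [t] and passing to the limit bounds [phi t - phi s - G (t - s)] by [eps |t - s|].
    Convergence along [node_filter] is what makes the estimate uniform over these increments. *)
Lemma is_derive_node_limit (s G : R) :
  filterlim (fun z => INR (N (fst z)) * (f (fst z) (snd z + 1)%Z - f (fst z) (snd z)))
    (node_filter s) (locally G) ->
  is_derive phi s G.
Proof.
  intros HG. split; [apply is_linear_scal_l|].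
  intros x Hx. rewrite <- (@is_filter_lim_locally_unique R_AbsRing (AbsRing_NormedModule R_AbsRing) s x Hx). clear x Hx.
  intros [eps Heps].
  destruct (filterlim_Rabs_lt _ _ _ HG Heps) as [d [Hd H1]].
  exists (mkposreal (d / 2) ltac:(lra)). intros t Ht.
  change (Rabs (t - s) < d / 2) in Ht.
  change (Rabs ((phi t - phi s) - (t - s) * G) <= eps * Rabs (t - s)).
  assert (Hlim : forall t', filterlim (fun n => (IZR (node t' n) - IZR (node s n)) / INR (N n))
      U (locally (t' - s))).
  { intros t'. eapply filterlim_ext.
    2: { apply filterlim_Rminus; apply filterlim_node_ratio. }
    intros n. simpl. unfold Rdiv. ring. }
  apply (filterlim_Rle (F := U)
    (fun n => Rabs ((f n (node t n) - f n (node s n)) - (IZR (node t n) - IZR (node s n)) / INR (N n) * G))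
    (fun n => eps * Rabs ((IZR (node t n) - IZR (node s n)) / INR (N n)))).
  (* [INR (N n) >= 2 / d] bounds the rounding error by [d / 2 * INR (N n)]; with [|t - s| < d / 2],
     every index between the two nodes stays in the window. *)
  - generalize (filter_and _ _ H1 (filter_and _ _ N_ge_1 (N_infty (2 / d)))). apply filter_imp.
    intros n [H2 [H3 H4]].
    assert (Hs := node_bounds s n). assert (Htn := node_bounds t n).
    assert (H5 : 1 <= d / 2 * INR (N n)).
    { apply Rle_trans with (d / 2 * (2 / d)); [right; field; lra|].
      apply Rmult_le_compat_l; lra. }
    assert (H6 : Rabs (f n (node t n) - f n (node s n) - G / INR (N n) * (IZR (node t n) - IZR (node s n)))
       <= eps / INR (N n) * Rabs (IZR (node t n) - IZR (node s n))).
    { apply increments_abs_le. intros k Hk.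
      assert (Hk' : Rabs (IZR k - s * INR (N n)) <= d * INR (N n)).
      { assert (Hts : Rabs (t * INR (N n) - s * INR (N n)) <= d / 2 * INR (N n)).
        { rewrite <- Rmult_minus_distr_r, Rabs_mult, (Rabs_pos_eq (INR (N n))) by lra.
          apply Rmult_le_compat_r; lra. }
        apply Rabs_le_between in Hts. apply Rabs_le.
        destruct (Z_le_gt_dec (node s n) (node t n)) as [h|h].
        - rewrite Z.min_l, Z.max_r in Hk by lia. destruct Hk as [Hk1 Hk2].
          apply IZR_le in Hk1. apply IZR_lt in Hk2. lra.
        - rewrite Z.min_r, Z.max_l in Hk by lia. destruct Hk as [Hk1 Hk2].
          apply IZR_le in Hk1. apply IZR_lt in Hk2. lra. }
      specialize (H2 k Hk'). simpl in H2.
      apply (Rmult_le_reg_l (INR (N n))); [lra|].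
      rewrite <- (Rabs_pos_eq (INR (N n))) at 1 by lra. rewrite <- Rabs_mult.
      replace (INR (N n) * (f n (k + 1)%Z - f n k - G / INR (N n)))
        with (INR (N n) * (f n (k + 1)%Z - f n k) - G) by (field; lra).
      replace (INR (N n) * (eps / INR (N n))) with eps by (field; lra).
      apply Rlt_le, H2. }
    unfold Rdiv at 2. rewrite Rabs_mult, (Rabs_pos_eq (/ INR (N n)))
      by (apply Rlt_le, Rinv_0_lt_compat; lra).
    replace (eps * (Rabs (IZR (node t n) - IZR (node s n)) * / INR (N n)))
      with (eps / INR (N n) * Rabs (IZR (node t n) - IZR (node s n))) by (unfold Rdiv; ring).
    replace ((IZR (node t n) - IZR (node s n)) / INR (N n) * G)
      with (G / INR (N n) * (IZR (node t n) - IZR (node s n))) by (unfold Rdiv; ring).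
    exact H6.
  - eapply filterlim_comp; [|apply (continuous_Rabs (phi t - phi s - (t - s) * G))].
    apply filterlim_Rminus; [apply filterlim_Rminus; apply f_lim|].
    apply filterlim_Rmult; [apply Hlim|apply filterlim_const].
  - apply filterlim_Rmult; [apply filterlim_const|].
    eapply filterlim_comp; [apply Hlim|apply (continuous_Rabs (t - s))].
Qed.

End Function.

(** Plays the part of Arzela-Ascoli: an ultralimit is chosen for each [t] separately. It exists
    because [node t n] is at most [(|t| + 1) N n] steps from index 0, each of size at most
    [C / N n]. *)
Lemma node_limit_exists (f : nat -> Z -> R) (B C : R) :
  (forall P, U P \/ U (fun n => ~ P n)) ->
  U (fun n => Rabs (f n 0%Z) <= B) ->
  U (fun n => forall i, Rabs (INR (N n) * (f n (i + 1)%Z - f n i)) <= C) ->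
  exists phi : R -> R, forall t, filterlim (fun n => f n (node t n)) U (locally (phi t)).
Proof.
  intros ultra HB HC.
  apply (choice (fun t l => filterlim (fun n => f n (node t n)) U (locally l))).
  intros t. apply (ultralimit_bounded_exists U _ (B + C * (Rabs t + 1)) HU ultra).
  generalize (filter_and _ _ HB (filter_and _ _ HC N_ge_1)). apply filter_imp.
  intros n [H1 [H2 H3]].
  assert (H4 : Rabs (f n (node t n) - f n 0%Z - 0 * (IZR (node t n) - IZR 0))
     <= C / INR (N n) * Rabs (IZR (node t n) - IZR 0)).
  { apply increments_abs_le. intros k _. rewrite Rminus_0_r.
    specialize (H2 k). rewrite Rabs_mult, (Rabs_pos_eq (INR (N n))) in H2 by lra.
    apply (Rmult_le_reg_l (INR (N n))); [lra|].
    replace (INR (N n) * (C / INR (N n))) with C by (field; lra). exact H2. }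
  rewrite Rmult_0_l, !Rminus_0_r in H4.
  assert (Hb := node_bounds t n).
  assert (HC0 : 0 <= C) by (eapply Rle_trans; [apply Rabs_pos|apply (H2 0%Z)]).
  assert (H5 : Rabs (IZR (node t n)) <= (Rabs t + 1) * INR (N n)).
  { assert (Ht : - Rabs t <= t <= Rabs t) by (apply Rabs_le_between; lra).
    assert (- Rabs t * INR (N n) <= t * INR (N n)) by (apply Rmult_le_compat_r; lra).
    assert (t * INR (N n) <= Rabs t * INR (N n)) by (apply Rmult_le_compat_r; lra).
    apply Rabs_le. lra. }
  assert (H6 : C / INR (N n) * Rabs (IZR (node t n)) <= C * (Rabs t + 1)).
  { apply Rle_trans with (C / INR (N n) * ((Rabs t + 1) * INR (N n))).
    - apply Rmult_le_compat_l; [|exact H5].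
      apply Rmult_le_pos; [exact HC0|apply Rlt_le, Rinv_0_lt_compat; lra].
    - right. field. lra. }
  replace (f n (node t n)) with ((f n (node t n) - f n 0%Z) + f n 0%Z) by ring.
  eapply Rle_trans; [apply Rabs_triang|]. lra.
Qed.

End Rescaling.

(** * Periodic sequences *)

Fixpoint zsum (f : Z -> R) (n : nat) : R :=
  match n with
  | O => 0
  | S k => zsum f k + f (Z.of_nat k)
  end.

Definition periodic (N : nat) (f : Z -> R) : Prop :=
  forall i, f (i + Z.of_nat N)%Z = f i.

Definition fwd (f : Z -> R) (i : Z) : R := f (i + 1)%Z - f i.
(** Central differences are antisymmetric under periodic summation by parts ([zsum_ctr_by_parts]);
    forward differences turn into backward ones. *)
Definition ctr (f : Z -> R) (i : Z) : R := (f (i + 1)%Z - f (i - 1)%Z) / 2.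

Lemma zsum_ext (f g : Z -> R) (n : nat) :
  (forall i, f i = g i) -> zsum f n = zsum g n.
Proof. intros H. induction n as [|n IH]; simpl; [reflexivity|]. now rewrite IH, H. Qed.

Lemma zsum_plus (f g : Z -> R) (n : nat) :
  zsum (fun i => f i + g i) n = zsum f n + zsum g n.
Proof. induction n as [|n IH]; simpl; [ring|]. rewrite IH. ring. Qed.

Lemma zsum_minus (f g : Z -> R) (n : nat) :
  zsum (fun i => f i - g i) n = zsum f n - zsum g n.
Proof. induction n as [|n IH]; simpl; [ring|]. rewrite IH. ring. Qed.

Lemma zsum_scal (k : R) (f : Z -> R) (n : nat) :
  zsum (fun i => k * f i) n = k * zsum f n.
Proof. induction n as [|n IH]; simpl; [ring|]. rewrite IH. ring. Qed.

Lemma zsum_const (k : R) (n : nat) : zsum (fun _ => k) n = INR n * k.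
Proof. induction n as [|n IH]; [simpl; ring|]. rewrite S_INR. simpl zsum. rewrite IH. ring. Qed.

Lemma zsum_le (f g : Z -> R) (n : nat) :
  (forall i, (0 <= i < Z.of_nat n)%Z -> f i <= g i) -> zsum f n <= zsum g n.
Proof.
  induction n as [|n IH]; intros H; simpl; [lra|].
  apply Rplus_le_compat; [apply IH; intros; apply H; lia|apply H; lia].
Qed.

Lemma zsum_nonneg (f : Z -> R) (n : nat) : (forall i, 0 <= f i) -> 0 <= zsum f n.
Proof.
  intros H. replace 0 with (zsum (fun _ => 0) n) by (rewrite zsum_const; ring).
  apply zsum_le; auto.
Qed.

Lemma zsum_abs (f : Z -> R) (n : nat) :
  Rabs (zsum f n) <= zsum (fun i => Rabs (f i)) n.
Proof.
  induction n as [|n IH]; simpl; [rewrite Rabs_R0; lra|].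
  eapply Rle_trans; [apply Rabs_triang|]. lra.
Qed.

Lemma zsum_ge_term (f : Z -> R) (n : nat) (i : Z) :
  (forall j, 0 <= f j) -> (0 <= i < Z.of_nat n)%Z -> f i <= zsum f n.
Proof.
  intros Hf. induction n as [|n IH]; intros Hi; [lia|]. simpl.
  destruct (Z.eq_dec i (Z.of_nat n)) as [->|Hne].
  - assert (H := zsum_nonneg f n Hf). lra.
  - assert (H := Hf (Z.of_nat n)). assert (f i <= zsum f n) by (apply IH; lia). lra.
Qed.

Lemma zsum_fwd (f : Z -> R) (n : nat) : zsum (fwd f) n = f (Z.of_nat n) - f 0%Z.
Proof.
  induction n as [|n IH]; [simpl; ring|].
  simpl zsum. rewrite IH. unfold fwd. rewrite Nat2Z.inj_succ.
  unfold Z.succ. ring.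
Qed.

Lemma zsum_succ (N : nat) (f : Z -> R) :
  periodic N f -> zsum (fun i => f (i + 1)%Z) N = zsum f N.
Proof.
  intros Hf. assert (H := zsum_fwd f N).
  unfold fwd in H. rewrite zsum_minus in H. specialize (Hf 0%Z). rewrite Z.add_0_l in Hf.
  rewrite Hf in H. lra.
Qed.

Lemma zsum_pred (N : nat) (f : Z -> R) :
  periodic N f -> zsum (fun i => f (i - 1)%Z) N = zsum f N.
Proof.
  intros Hf. rewrite <- (zsum_succ N (fun i => f (i - 1)%Z)).
  - apply zsum_ext. intros i. f_equal. lia.
  - intros i. rewrite <- (Hf (i - 1)%Z). f_equal. lia.
Qed.

Lemma periodic_succ (N : nat) (f : Z -> R) : periodic N f -> periodic N (fun i => f (i + 1)%Z).
Proof. intros H i. rewrite <- (H (i + 1)%Z). f_equal. lia. Qed.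

Lemma periodic_pred (N : nat) (f : Z -> R) : periodic N f -> periodic N (fun i => f (i - 1)%Z).
Proof. intros H i. rewrite <- (H (i - 1)%Z). f_equal. lia. Qed.

Lemma periodic_fwd (N : nat) (f : Z -> R) : periodic N f -> periodic N (fwd f).
Proof. intros H i. unfold fwd. rewrite (periodic_succ N f H i), (H i). reflexivity. Qed.

Lemma periodic_ctr (N : nat) (f : Z -> R) : periodic N f -> periodic N (ctr f).
Proof.
  intros H i. unfold ctr. rewrite (periodic_succ N f H i), (periodic_pred N f H i). reflexivity.
Qed.

Lemma periodic_mult (N : nat) (f g : Z -> R) :
  periodic N f -> periodic N g -> periodic N (fun i => f i * g i).
Proof. intros Hf Hg i. now rewrite (Hf i), (Hg i). Qed.

Lemma periodic_mod (N : nat) (f : Z -> R) (i : Z) :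
  (0 < N)%nat -> periodic N f -> f i = f (i mod Z.of_nat N)%Z.
Proof.
  intros HN Hf.
  assert (Hk : forall k j, f (j + Z.of_nat k * Z.of_nat N)%Z = f j).
  { induction k as [|k IH]; intros j; [f_equal; lia|].
    rewrite <- (IH j), <- (Hf (j + Z.of_nat k * Z.of_nat N)%Z). f_equal. lia. }
  assert (Hd := Z.div_mod i (Z.of_nat N) ltac:(lia)).
  set (q := (i / Z.of_nat N)%Z) in *. set (r := (i mod Z.of_nat N)%Z) in *.
  destruct (Z_le_gt_dec 0 q) as [h|h].
  - rewrite <- (Hk (Z.to_nat q) r). f_equal. rewrite Z2Nat.id by lia. lia.
  - rewrite <- (Hk (Z.to_nat (- q)) i). f_equal. rewrite Z2Nat.id by lia. lia.
Qed.

Lemma periodic_forall (N : nat) (f : Z -> R) (P : R -> Prop) :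
  (0 < N)%nat -> periodic N f ->
  (forall i, (0 <= i < Z.of_nat N)%Z -> P (f i)) -> forall i, P (f i).
Proof.
  intros HN Hf H i. rewrite (periodic_mod N f i HN Hf). apply H.
  apply Z.mod_pos_bound. lia.
Qed.

Lemma zsum_mul_succ (N : nat) (f g : Z -> R) : periodic N f -> periodic N g ->
  zsum (fun i => f i * g (i + 1)%Z) N = zsum (fun i => f (i - 1)%Z * g i) N.
Proof.
  intros Hf Hg. rewrite <- (zsum_succ N (fun i => f (i - 1)%Z * g i)).
  - apply zsum_ext. intros i. replace (i + 1 - 1)%Z with i by lia. reflexivity.
  - apply periodic_mult; [now apply periodic_pred|exact Hg].
Qed.

Lemma zsum_mul_pred (N : nat) (f g : Z -> R) : periodic N f -> periodic N g ->
  zsum (fun i => f i * g (i - 1)%Z) N = zsum (fun i => f (i + 1)%Z * g i) N.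
Proof.
  intros Hf Hg. rewrite <- (zsum_pred N (fun i => f (i + 1)%Z * g i)).
  - apply zsum_ext. intros i. replace (i - 1 + 1)%Z with i by lia. reflexivity.
  - apply periodic_mult; [now apply periodic_succ|exact Hg].
Qed.

Lemma zsum_ctr_by_parts (N : nat) (f g : Z -> R) : periodic N f -> periodic N g ->
  zsum (fun i => f i * ctr g i) N = - zsum (fun i => ctr f i * g i) N.
Proof.
  intros Hf Hg.
  transitivity (/ 2 * (zsum (fun i => f i * g (i + 1)%Z) N - zsum (fun i => f i * g (i - 1)%Z) N)).
  { rewrite <- zsum_minus, <- zsum_scal. apply zsum_ext. intros i. unfold ctr. field. }
  rewrite (zsum_mul_succ N f g Hf Hg), (zsum_mul_pred N f g Hf Hg).
  transitivity (/ 2 * (zsum (fun i => f (i - 1)%Z * g i) N - zsum (fun i => f (i + 1)%Z * g i) N));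
    [reflexivity|].
  rewrite <- zsum_minus, <- zsum_scal, <- (Rmult_1_l (zsum (fun i => ctr f i * g i) N)),
    <- Ropp_mult_distr_l_reverse, <- zsum_scal.
  apply zsum_ext. intros i. unfold ctr. field.
Qed.

Lemma zsum_fwd_by_parts (N : nat) (f g : Z -> R) : periodic N f -> periodic N g ->
  zsum (fun i => fwd f i * fwd g i) N = zsum (fun i => (fwd f (i - 1)%Z - fwd f i) * g i) N.
Proof.
  intros Hf Hg. assert (Hd := periodic_fwd N f Hf).
  transitivity (zsum (fun i => fwd f i * g (i + 1)%Z) N - zsum (fun i => fwd f i * g i) N).
  { rewrite <- zsum_minus. apply zsum_ext. intros i. unfold fwd. ring. }
  rewrite (zsum_mul_succ N (fwd f) g Hd Hg), <- zsum_minus.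
  apply zsum_ext. intros i. ring.
Qed.

Lemma zsum_cauchy_schwarz_1 (f : Z -> R) (n : nat) :
  zsum f n ^ 2 <= INR n * zsum (fun i => f i ^ 2) n.
Proof.
  induction n as [|n IH]; [simpl; lra|].
  rewrite S_INR.
  change (zsum f (S n)) with (zsum f n + f (Z.of_nat n)).
  change (zsum (fun i => f i ^ 2) (S n)) with (zsum (fun i => f i ^ 2) n + f (Z.of_nat n) ^ 2).
  set (s := zsum f n) in *. set (q := zsum (fun i => f i ^ 2) n) in *.
  set (b := f (Z.of_nat n)). assert (Hn := pos_INR n).
  (* Expand [(s - n b)^2 >= 0], replace [s^2] by [n q] with the induction hypothesis and divide by
     [n]; hence the separate case [n = 0]. *)
  assert (H2 : 2 * s * b <= q + INR n * b ^ 2).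
  { destruct (Rle_lt_or_eq_dec 0 (INR n) Hn) as [Hp|H0].
    - apply (Rmult_le_reg_l (INR n)); [exact Hp|].
      assert (0 <= (s - INR n * b) ^ 2) by apply pow2_ge_0. nra.
    - rewrite <- H0 in IH |- *. assert (s = 0) by nra.
      assert (0 <= q) by (apply zsum_nonneg; intros; apply pow2_ge_0). rewrite H. lra. }
  replace ((INR n + 1) * (q + b ^ 2))
    with (INR n * q + (q + INR n * b ^ 2) + b ^ 2) by ring.
  replace ((s + b) ^ 2) with (s ^ 2 + 2 * s * b + b ^ 2) by ring. lra.
Qed.

Lemma zsum_variation (f : Z -> R) (n : nat) (i : Z) :
  (0 <= i < Z.of_nat n)%Z -> Rabs (f i - f 0%Z) <= zsum (fun j => Rabs (fwd f j)) n.
Proof.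
  intros Hi. rewrite <- (Z2Nat.id i) by lia. rewrite <- zsum_fwd.
  eapply Rle_trans; [apply zsum_abs|].
  assert (Hm : (Z.to_nat i <= n)%nat) by lia. revert Hm. generalize (Z.to_nat i) as m. intros m Hm.
  clear i Hi. induction Hm as [|n Hm IH]; [lra|]. simpl.
  assert (H := Rabs_pos (fwd f (Z.of_nat n))). lra.
Qed.

(** As the sum vanishes, [f 0] is minus the average of the [f j - f 0], so the variation bounds it;
    passing from index 0 to [i] costs the variation once more. It serves for the velocities, whose
    sum vanishes because the polygon closes. *)
Lemma periodic_mean_zero_bound (N : nat) (f : Z -> R) (i : Z) :
  (0 < N)%nat -> periodic N f -> zsum f N = 0 ->
  Rabs (f i) <= 2 * zsum (fun j => Rabs (fwd f j)) N.
Proof.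
  intros HN Hf H0. set (W := zsum (fun j => Rabs (fwd f j)) N).
  assert (HV : forall j, Rabs (f j - f 0%Z) <= W).
  { intros j. rewrite (periodic_mod N f j HN Hf). apply zsum_variation.
    apply Z.mod_pos_bound; lia. }
  assert (HNR : 0 < INR N) by (apply lt_0_INR; exact HN).
  assert (Hf0 : Rabs (f 0%Z) <= W).
  { apply (Rmult_le_reg_l (INR N)); [exact HNR|].
    rewrite <- (Rabs_pos_eq (INR N)) at 1 by lra. rewrite <- Rabs_mult.
    rewrite <- (zsum_const W), <- (zsum_const (f 0%Z)).
    replace (zsum (fun _ => f 0%Z) N) with (- zsum (fun j => f j - f 0%Z) N).
    2: { rewrite zsum_minus, H0. ring. }
    rewrite Rabs_Ropp. eapply Rle_trans; [apply zsum_abs|]. apply zsum_le. intros; apply HV. }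
  replace (f i) with ((f i - f 0%Z) + f 0%Z) by ring.
  eapply Rle_trans; [apply Rabs_triang|]. specialize (HV i). lra.
Qed.

Lemma is_derive_zsum (f : R -> Z -> R) (df : Z -> R) (t : R) (n : nat) :
  (forall i, is_derive (fun s => f s i) t (df i)) ->
  is_derive (fun s => zsum (f s) n) t (zsum df n).
Proof.
  intros H. induction n as [|n IH]; simpl.
  - exact (is_derive_const (K := R_AbsRing) (V := R_NormedModule) 0 t).
  - exact (is_derive_plus (fun s => zsum (f s) n) _ t _ _ IH (H _)).
Qed.

Lemma filterlim_zsum {T : Type} {F : (T -> Prop) -> Prop} {FF : Filter F}
  (f : T -> Z -> R) (l : Z -> R) (n : nat) :
  (forall i, filterlim (fun s => f s i) F (locally (l i))) ->
  filterlim (fun s => zsum (f s) n) F (locally (zsum l n)).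
Proof.
  intros H. induction n as [|n IH]; simpl.
  - apply filterlim_const.
  - exact (filterlim_comp_2 _ _ _ IH (H _) (filterlim_plus _ _)).
Qed.

(** Two-sided, because nodes can be negative. Area and energy become sequences with prescribed
    increments, so they pass to the limit as primitives, just like the positions, and no Riemann
    sums have to be compared with integrals. *)
Lemma zsum_antidifference (f : Z -> R) :
  exists S, S 0%Z = 0 /\ (forall i, fwd S i = f i) /\ forall n, S (Z.of_nat n) = zsum f n.
Proof.
  exists (fun i => zsum f (Z.to_nat i) - zsum (fun j => f (- j - 1)%Z) (Z.to_nat (- i))).
  split; [simpl; ring|split].
  - intros i. unfold fwd. destruct (Z_le_gt_dec 0 i) as [h|h].
    + replace (Z.to_nat (- (i + 1))) with 0%nat by lia. replace (Z.to_nat (- i)) with 0%nat by lia.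
      replace (Z.to_nat (i + 1)) with (S (Z.to_nat i)) by lia. simpl.
      rewrite Z2Nat.id by lia. ring.
    + replace (Z.to_nat (i + 1)) with 0%nat by lia. replace (Z.to_nat i) with 0%nat by lia.
      replace (Z.to_nat (- i)) with (S (Z.to_nat (- (i + 1)))) by lia. simpl zsum.
      rewrite Z2Nat.id by lia. replace (- - (i + 1) - 1)%Z with i by lia. ring.
  - intros n. rewrite Nat2Z.id. replace (Z.to_nat (- Z.of_nat n)) with 0%nat by lia. simpl. ring.
Qed.

(** * Periodic primitives *)

Definition unif2 (g : R -> R -> R) : Prop :=
  forall eps, 0 < eps -> exists d, 0 < d /\ forall x y x' y',
    Rabs (x - x') <= d -> Rabs (y - y') <= d -> Rabs (g x y - g x' y') <= eps.

(** Two points near [(x, y)] are compared, uniformly in the base point: a central difference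
    involves vertices [i - 1] and [i + 1], whereas the derivative is taken at vertex [i]. *)
Definition strict_diff (f fx fy : R -> R -> R) : Prop :=
  forall eps, 0 < eps -> exists d, 0 < d /\ forall x y x1 y1 x2 y2,
    Rabs (x1 - x) <= d -> Rabs (y1 - y) <= d -> Rabs (x2 - x) <= d -> Rabs (y2 - y) <= d ->
    Rabs (f x2 y2 - f x1 y1 - (fx x y * (x2 - x1) + fy x y * (y2 - y1)))
      <= eps * (Rabs (x2 - x1) + Rabs (y2 - y1)).

Lemma is_derive_continuous_R (f : R -> R) (x l : R) : is_derive f x l -> continuous f x.
Proof.
  intros H. apply (ex_derive_continuous (K := R_AbsRing) (V := R_NormedModule) f x). now exists l.
Qed.

Lemma continuous_Rplus (f g : R -> R) (x : R) :
  continuous f x -> continuous g x -> continuous (fun t => f t + g t) x.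
Proof. exact (continuous_plus (K := R_AbsRing) (V := R_NormedModule) f g x). Qed.

Lemma continuous_Rminus (f g : R -> R) (x : R) :
  continuous f x -> continuous g x -> continuous (fun t => f t - g t) x.
Proof. exact (continuous_minus (K := R_AbsRing) (V := R_NormedModule) f g x). Qed.

Lemma continuous_Rmult (f g : R -> R) (x : R) :
  continuous f x -> continuous g x -> continuous (fun t => f t * g t) x.
Proof. exact (continuous_mult (K := R_AbsRing) f g x). Qed.

Lemma is_derive_Rminus (f g : R -> R) (x a b : R) :
  is_derive f x a -> is_derive g x b -> is_derive (fun t => f t - g t) x (a - b).
Proof. exact (is_derive_minus (K := R_AbsRing) (V := R_NormedModule) f g x a b). Qed.

Lemma is_derive_Rplus (f g : R -> R) (x a b : R) :
  is_derive f x a -> is_derive g x b -> is_derive (fun t => f t + g t) x (a + b).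
Proof. exact (is_derive_plus (K := R_AbsRing) (V := R_NormedModule) f g x a b). Qed.

Lemma is_derive_Rmult (f g : R -> R) (x a b : R) :
  is_derive f x a -> is_derive g x b -> is_derive (fun t => f t * g t) x (a * g x + f x * b).
Proof.
  intros Hf Hg.
  exact (is_derive_mult (K := R_AbsRing) f g x a b Hf Hg Rmult_comm).
Qed.

Lemma mean_value (f df : R -> R) (a b : R) :
  (forall x, is_derive f x (df x)) ->
  exists c, Rmin a b <= c <= Rmax a b /\ f b - f a = df c * (b - a).
Proof.
  intros Hf. apply MVT_gen; intros x _; [apply Hf|].
  apply continuity_pt_filterlim. now apply (is_derive_continuous_R f x (df x)).
Qed.

Lemma Rabs_between_le (a b c x d : R) :
  Rmin a b <= c <= Rmax a b -> Rabs (a - x) <= d -> Rabs (b - x) <= d -> Rabs (c - x) <= d.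
Proof.
  intros Hc Ha Hb. apply Rabs_le_between in Ha. apply Rabs_le_between in Hb.
  apply Rabs_le. revert Hc. unfold Rmin, Rmax. destruct (Rle_dec a b); lra.
Qed.

(** Mean value theorem on both legs of the axis-parallel path from [(x1, y1)] through [(x1, y2)] to
    [(x2, y2)]. *)
Lemma strict_diff_of_partials (f fx fy : R -> R -> R) :
  (forall x y, is_derive (fun t => f t y) x (fx x y)) ->
  (forall x y, is_derive (fun t => f x t) y (fy x y)) ->
  unif2 fx -> unif2 fy -> strict_diff f fx fy.
Proof.
  intros Hx Hy Ux Uy eps Heps.
  destruct (Ux eps Heps) as [d1 [Hd1 H1]]. destruct (Uy eps Heps) as [d2 [Hd2 H2]].
  exists (Rmin d1 d2). split; [apply Rmin_glb_lt; lra|].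
  intros x y x1 y1 x2 y2 A1 B1 A2 B2.
  assert (M1 := Rmin_l d1 d2). assert (M2 := Rmin_r d1 d2).
  destruct (mean_value (fun t => f t y2) (fun t => fx t y2) x1 x2) as [c [Hc E1]]; [intros; apply Hx|].
  destruct (mean_value (fun t => f x1 t) (fun t => fy x1 t) y1 y2) as [e [He E2]]; [intros; apply Hy|].
  assert (Kc := Rabs_between_le _ _ _ x (Rmin d1 d2) Hc A1 A2).
  assert (Ke := Rabs_between_le _ _ _ y (Rmin d1 d2) He B1 B2).
  assert (F1 : Rabs (fx c y2 - fx x y) <= eps) by (apply H1; lra).
  assert (F2 : Rabs (fy x1 e - fy x y) <= eps) by (apply H2; lra).
  replace (f x2 y2 - f x1 y1 - (fx x y * (x2 - x1) + fy x y * (y2 - y1)))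
    with ((fx c y2 - fx x y) * (x2 - x1) + (fy x1 e - fy x y) * (y2 - y1)).
  2: { replace (f x2 y2 - f x1 y1) with ((f x2 y2 - f x1 y2) + (f x1 y2 - f x1 y1)) by ring.
       rewrite E1, E2. ring. }
  eapply Rle_trans; [apply Rabs_triang|]. rewrite !Rabs_mult, Rmult_plus_distr_l.
  apply Rplus_le_compat; apply Rmult_le_compat_r; auto using Rabs_pos.
Qed.

Lemma continuous_of_modulus (f : R -> R) (x : R) :
  (forall eps, 0 < eps -> exists d, 0 < d /\ forall y, Rabs (x - y) <= d -> Rabs (f x - f y) <= eps) ->
  continuous f x.
Proof.
  intros H. apply filterlim_locally. intros [eps Heps].
  destruct (H (eps / 2) ltac:(lra)) as [d [Hd H1]].
  exists (mkposreal d Hd). intros y Hy. change (Rabs (y - x) < d) in Hy.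
  change (Rabs (f y - f x) < eps). rewrite Rabs_minus_sym in Hy. rewrite Rabs_minus_sym.
  specialize (H1 y). simpl in *. lra.
Qed.

Lemma unif2_continuous_l (g : R -> R -> R) (x y : R) : unif2 g -> continuous (fun t => g t y) x.
Proof.
  intros H. apply continuous_of_modulus. intros eps Heps.
  destruct (H eps Heps) as [d [Hd H1]]. exists d. split; [exact Hd|].
  intros t Ht. apply H1; [exact Ht|]. rewrite Rminus_eq_0, Rabs_R0. lra.
Qed.

Lemma unif2_continuous_r (g : R -> R -> R) (x y : R) : unif2 g -> continuous (g x) y.
Proof.
  intros H. apply continuous_of_modulus. intros eps Heps.
  destruct (H eps Heps) as [d [Hd H1]]. exists d. split; [exact Hd|].
  intros t Ht. apply H1; [|exact Ht]. rewrite Rminus_eq_0, Rabs_R0. lra.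
Qed.

Lemma ex_RInt_cont (f : R -> R) (a b : R) : (forall x, continuous f x) -> ex_RInt f a b.
Proof. intros H. apply (ex_RInt_continuous (V := R_CompleteNormedModule)). auto. Qed.

Lemma RInt_split (f : R -> R) (a b c : R) : (forall x, continuous f x) ->
  RInt f a c = RInt f a b + RInt f b c.
Proof.
  intros Hf. symmetry. apply (RInt_Chasles (V := R_CompleteNormedModule)); now apply ex_RInt_cont.
Qed.

Lemma RInt_Rminus (f g : R -> R) (a b : R) :
  (forall x, continuous f x) -> (forall x, continuous g x) ->
  RInt (fun x => f x - g x) a b = RInt f a b - RInt g a b.
Proof.
  intros Hf Hg. apply (RInt_minus (V := R_CompleteNormedModule)); now apply ex_RInt_cont.
Qed.

Lemma RInt_Rscal (k : R) (f : R -> R) (a b : R) : (forall x, continuous f x) ->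
  RInt (fun x => k * f x) a b = k * RInt f a b.
Proof.
  intros Hf. apply (RInt_scal (V := R_CompleteNormedModule)); now apply ex_RInt_cont.
Qed.

Lemma RInt_diff_le (f g : R -> R) (e : R) :
  (forall x, continuous f x) -> (forall x, continuous g x) ->
  (forall s, 0 <= s <= 1 -> Rabs (f s - g s) <= e) ->
  Rabs (RInt f 0 1 - RInt g 0 1) <= e.
Proof.
  intros Hf Hg H.
  rewrite <- RInt_Rminus by assumption.
  replace e with ((1 - 0) * e) by ring. apply abs_RInt_le_const; [lra| |exact H].
  apply ex_RInt_cont. intros x. now apply continuous_Rminus.
Qed.

(* Convolution with the periodised first Bernoulli polynomial [s - 1/2] inverts [d/dy] on
   mean-zero 1-periodic functions, with the optimal constant [int_0^1 |s - 1/2| ds = 1/4]. *)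
Definition bernoulli_conv (f : R -> R) (y : R) : R :=
  RInt (fun s => (s - / 2) * f (s + y)) 0 1.

Lemma continuous_shift (f : R -> R) (y : R) :
  (forall x, continuous f x) -> forall s, continuous (fun s => f (s + y)) s.
Proof.
  intros Hf s. apply (continuous_comp (fun s => s + y) f); [|apply Hf].
  apply continuous_Rplus; [apply continuous_id|apply continuous_const].
Qed.

Lemma continuous_bernoulli_integrand (f : R -> R) (y : R) :
  (forall x, continuous f x) -> forall s, continuous (fun s => (s - / 2) * f (s + y)) s.
Proof.
  intros Hf s. apply continuous_Rmult; [|now apply continuous_shift].
  apply continuous_Rminus; [apply continuous_id|apply continuous_const].
Qed.

Lemma bernoulli_conv_bound (f : R -> R) (c y : R) :
  (forall x, continuous f x) -> (forall x, Rabs (f x) <= c) ->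
  Rabs (bernoulli_conv f y) <= c / 4.
Proof.
  intros Hf Hc. unfold bernoulli_conv.
  assert (Hi := fun a b => ex_RInt_cont _ a b (continuous_bernoulli_integrand f y Hf)).
  rewrite (RInt_split (fun s : R => (s - / 2) * f (s + y)) 0 (/ 2) 1 (continuous_bernoulli_integrand f y Hf)).
  assert (H1 : forall a b k, is_RInt (fun s => k * (s - / 2)) a b (k * ((b - / 2) ^ 2 / 2) - k * ((a - / 2) ^ 2 / 2))).
  { intros a b k.
    apply (is_RInt_derive (V := R_CompleteNormedModule) (fun s => k * ((s - / 2) ^ 2 / 2))); intros x _.
    - auto_derive; [exact I|]. field.
    - apply continuous_Rmult; [apply continuous_const|].
      apply continuous_Rminus; [apply continuous_id|apply continuous_const]. }
  assert (H2 : forall s, Rabs ((s - / 2) * f (s + y)) <= c * Rabs (s - / 2)).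
  { intros s. rewrite Rabs_mult, Rmult_comm. apply Rmult_le_compat_r; [apply Rabs_pos|apply Hc]. }
  (* On each half of the interval [s - 1/2] has constant sign and its absolute value integrates to
     1/8. *)
  assert (L1 : Rabs (RInt (fun s => (s - / 2) * f (s + y)) 0 (/ 2)) <= c / 8).
  { assert (E : c / 8 = RInt (fun s => - c * (s - / 2)) 0 (/ 2)).
    { rewrite (is_RInt_unique _ _ _ _ (H1 0 (/ 2) (- c))). field. }
    rewrite E.
    eapply Rle_trans; [apply abs_RInt_le; [lra|apply Hi]|].
    apply RInt_le; [lra| |eexists; apply H1|].
    - apply ex_RInt_cont. intros x. apply (continuous_comp (fun s => (s - / 2) * f (s + y)) Rabs);
        [now apply continuous_bernoulli_integrand|apply continuous_Rabs].
    - intros s Hs. eapply Rle_trans; [apply H2|]. rewrite Rabs_left by lra. right; ring. }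
  assert (L2 : Rabs (RInt (fun s => (s - / 2) * f (s + y)) (/ 2) 1) <= c / 8).
  { assert (E : c / 8 = RInt (fun s => c * (s - / 2)) (/ 2) 1).
    { rewrite (is_RInt_unique _ _ _ _ (H1 (/ 2) 1 c)). field. }
    rewrite E.
    eapply Rle_trans; [apply abs_RInt_le; [lra|apply Hi]|].
    apply RInt_le; [lra| |eexists; apply H1|].
    - apply ex_RInt_cont. intros x. apply (continuous_comp (fun s => (s - / 2) * f (s + y)) Rabs);
        [now apply continuous_bernoulli_integrand|apply continuous_Rabs].
    - intros s Hs. eapply Rle_trans; [apply H2|]. rewrite Rabs_pos_eq by lra. right; ring. }
  eapply Rle_trans; [apply Rabs_triang|]. lra.
Qed.

Lemma is_derive_window (f : R -> R) (w y : R) :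
  (forall x, continuous f x) ->
  is_derive (fun y => RInt f y (y + w)) y (f (y + w) - f y).
Proof.
  intros Hf.
  apply (is_derive_ext (fun y => RInt f 0 (y + w) - RInt f 0 y)).
  { intros t. rewrite (RInt_split f 0 t (t + w) Hf). simpl. ring. }
  assert (HI : forall x, is_derive (fun b => RInt f 0 b) x (f x)).
  { intros x. apply (is_derive_RInt f (fun b => RInt f 0 b) 0 x); [|apply Hf].
    apply filter_forall. intros b. apply (RInt_correct f). now apply ex_RInt_cont. }
  apply is_derive_Rminus; [|apply HI].
  replace (f (y + w)) with (scal 1 (f (y + w))) by (apply Rmult_1_l).
  apply (is_derive_comp (fun b => RInt f 0 b) (fun t => t + w)); [apply HI|].
  auto_derive; [exact I|ring].
Qed.

Lemma RInt_window (f : R -> R) (w y : R) : (forall x, continuous f x) ->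
  w * RInt (fun s => f (w * s + y)) 0 1 = RInt f y (y + w).
Proof.
  intros Hf.
  assert (H := RInt_comp_lin f w y 0 1 (ex_RInt_cont f _ _ Hf)).
  replace (w * 0 + y) with y in H by ring. replace (w * 1 + y) with (y + w) in H by ring.
  rewrite <- H. symmetry.
  apply (RInt_Rscal w (fun s => f (w * s + y))). intros x. apply (continuous_comp (fun s => w * s + y) f); [|apply Hf].
  apply continuous_Rplus; [|apply continuous_const].
  apply continuous_Rmult; [apply continuous_const|apply continuous_id].
Qed.

(** The substitution [z = s + y] moves the parameter out of the argument of [f], which is only
    continuous, into the bounds of integration: the convolution is the integral of [z f(z)] over
    [[y, y + 1]] minus [y + 1/2] times that of [f], the latter being constant by periodicity. *)
Lemma is_derive_bernoulli_conv (f : R -> R) (y : R) :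
  (forall x, continuous f x) -> (forall x, f (x + 1) = f x) ->
  is_derive (bernoulli_conv f) y (f y - RInt f 0 1).
Proof.
  intros Hf Hper.
  assert (Hid : forall x, continuous (fun z => z * f z) x).
  { intros x. apply continuous_Rmult; [apply continuous_id|apply Hf]. }
  apply (is_derive_ext (fun y : R => RInt (fun z : R => z * f z) y (y + 1) - (y + / 2) * RInt f y (y + 1))).
  { intros t. unfold bernoulli_conv.
    rewrite <- (RInt_window (fun z : R => z * f z) 1 t Hid), <- (RInt_window f 1 t Hf).
    assert (C0 : forall x, continuous (fun s => 1 * s + t) x).
    { intros x. apply continuous_Rplus; [|apply continuous_const].
      apply continuous_Rmult; [apply continuous_const|apply continuous_id]. }
    assert (C1 : forall x, continuous (fun s => f (1 * s + t)) x).
    { intros x. apply (continuous_comp (fun s => 1 * s + t) f); [apply C0|apply Hf]. }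
    assert (C2 : forall x, continuous (fun s => (1 * s + t) * f (1 * s + t)) x).
    { intros x. apply continuous_Rmult; [apply C0|apply C1]. }
    rewrite !Rmult_1_l.
    rewrite <- RInt_Rscal by exact C1. rewrite <- RInt_Rminus; [|exact C2|].
    - apply RInt_ext. intros s _. rewrite !Rmult_1_l. simpl. ring.
    - intros x. apply continuous_Rmult; [apply continuous_const|apply C1]. }
  assert (Hw : RInt f y (y + 1) = RInt f 0 1).
  { assert (Hd : forall t, is_derive (fun y => RInt f y (y + 1)) t 0).
    { intros t. assert (H := is_derive_window f 1 t Hf). rewrite Hper, Rminus_eq_0 in H. exact H. }
    destruct (mean_value _ _ 0 y Hd) as [c [_ E]]. rewrite Rplus_0_l in E. lra. }
  assert (E : f y - RInt f 0 1 = ((y + 1) * f (y + 1) - y * f y)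
    - (1 * RInt f y (y + 1) + (y + / 2) * (f (y + 1) - f y))).
  { rewrite Hw, Hper. ring. }
  rewrite E. apply is_derive_Rminus; [apply (is_derive_window _ 1 y Hid)|].
  apply (is_derive_Rmult (fun y => y + / 2) (fun y => RInt f y (y + 1))); [|apply (is_derive_window f 1 y Hf)].
  auto_derive; [exact I|ring].
Qed.

Lemma RInt_unit_bound (f : R -> R) (c : R) :
  (forall x, continuous f x) -> (forall s, Rabs (f s) <= c) -> Rabs (RInt f 0 1) <= c.
Proof.
  intros Hf Hc. replace c with ((1 - 0) * c) by ring.
  apply abs_RInt_le_const; [lra|now apply ex_RInt_cont|auto].
Qed.

Lemma periodic_IZR (f : R -> R) : (forall x, f (x + 1) = f x) -> forall x (n : Z), f (x + IZR n) = f x.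
Proof.
  intros Hf. assert (Hn : forall (n : nat) x, f (x + INR n) = f x).
  { induction n as [|n IH]; intros x; [simpl; f_equal; ring|].
    rewrite S_INR, <- Rplus_assoc, Hf. apply IH. }
  intros x n. destruct (Z_le_gt_dec 0 n) as [h|h].
  - rewrite <- (Z2Nat.id n) by lia. rewrite <- INR_IZR_INZ. apply Hn.
  - rewrite <- (Hn (Z.to_nat (- n)) (x + IZR n)). f_equal.
    rewrite INR_IZR_INZ, Z2Nat.id, opp_IZR by lia. ring.
Qed.

(** For [w > 0], the mean of [f] over [[x, x + w]]: differentiable in [x] for continuous [f], with
    no loss in sup norm. The fixed interval keeps sup bounds and parameter derivatives simple. *)
Definition window_avg (w : R) (f : R -> R) (x : R) : R := RInt (fun s => f (w * s + x)) 0 1.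

Lemma continuous_affine (f : R -> R) (w x : R) :
  (forall t, continuous f t) -> forall s, continuous (fun s => f (w * s + x)) s.
Proof.
  intros Hf s. apply (continuous_comp (fun s => w * s + x) f); [|apply Hf].
  apply continuous_Rplus; [|apply continuous_const].
  apply continuous_Rmult; [apply continuous_const|apply continuous_id].
Qed.

Lemma is_derive_window_avg (w : R) (f : R -> R) (x : R) :
  0 < w -> (forall t, continuous f t) ->
  is_derive (window_avg w f) x ((f (x + w) - f x) / w).
Proof.
  intros Hw Hf.
  apply (is_derive_ext (fun x => / w * RInt f x (x + w))).
  { intros t. unfold window_avg. rewrite <- RInt_window by exact Hf.
    simpl. field. lra. }
  unfold Rdiv. rewrite Rmult_comm.
  apply (is_derive_scal (fun x => RInt f x (x + w)) x (/ w)). now apply is_derive_window.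
Qed.

Lemma is_derive_window_avg_param (w : R) (F q : R -> R -> R) (x y : R) :
  unif2 F -> unif2 q ->
  (forall x y, is_derive (F x) y (q x y)) ->
  is_derive (fun y => window_avg w (fun t => F t y) x) y (window_avg w (fun t => q t y) x).
Proof.
  intros UF Uq HF. unfold window_avg.
  assert (E : RInt (fun s => q (w * s + x) y) 0 1
     = RInt (fun s => Derive (fun u => F (w * s + x) u) y) 0 1).
  { apply RInt_ext. intros s _. symmetry. apply is_derive_unique, HF. }
  rewrite E.
  apply (is_derive_RInt_param (fun y s => F (w * s + x) y) 0 1 y).
  - apply filter_forall. intros v s _. eexists. apply HF.
  - intros s _.
    apply (continuity_2d_pt_ext (fun u v => q (w * v + x) u)).
    { intros u v. symmetry. apply is_derive_unique, HF. }
    intros [eps Heps]. destruct (Uq (eps / 2) ltac:(lra)) as [d [Hd H1]].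
    assert (Hdw : 0 < d / (Rabs w + 1)).
    { apply Rdiv_lt_0_compat; [exact Hd|]. assert (H := Rabs_pos w). lra. }
    exists (mkposreal (Rmin d (d / (Rabs w + 1))) (Rmin_glb_lt _ _ _ Hd Hdw)). simpl.
    intros u v Hu Hv. apply Rle_lt_trans with (eps / 2); [|lra]. apply H1.
    + replace (w * v + x - (w * s + x)) with (w * (v - s)) by ring. rewrite Rabs_mult.
      assert (Hv' : Rabs (v - s) <= d / (Rabs w + 1)).
      { apply Rlt_le. eapply Rlt_le_trans; [exact Hv|apply Rmin_r]. }
      apply Rle_trans with ((Rabs w + 1) * (d / (Rabs w + 1))).
      * apply Rmult_le_compat; try apply Rabs_pos; [lra|exact Hv'].
      * right. field. assert (H := Rabs_pos w). lra.
    + apply Rlt_le. eapply Rlt_le_trans; [exact Hu|apply Rmin_l].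
  - apply filter_forall. intros v. apply ex_RInt_cont.
    apply (continuous_affine (fun t => F t v)). intros t. now apply unif2_continuous_l.
Qed.

Lemma unif2_window_avg (w : R) (q : R -> R -> R) :
  unif2 q -> unif2 (fun x y => window_avg w (fun t => q t y) x).
Proof.
  intros Uq eps Heps. destruct (Uq eps Heps) as [d [Hd H1]]. exists d. split; [exact Hd|].
  intros x y x' y' Hx Hy. unfold window_avg.
  apply RInt_diff_le.
  - apply (continuous_affine (fun t => q t y)). intros; now apply unif2_continuous_l.
  - apply (continuous_affine (fun t => q t y')). intros; now apply unif2_continuous_l.
  - intros s _. apply H1; [|exact Hy]. replace (w * s + x - (w * s + x')) with (x - x') by ring. exact Hx.
Qed.

Lemma unif2_bernoulli_conv (g : R -> R -> R) :
  unif2 g -> unif2 (fun x y => bernoulli_conv (g x) y).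
Proof.
  intros Ug eps Heps. destruct (Ug eps Heps) as [d [Hd H1]]. exists d. split; [exact Hd|].
  intros x y x' y' Hx Hy. unfold bernoulli_conv.
  assert (C : forall a b, continuous (g a) b) by (intros; now apply unif2_continuous_r).
  apply RInt_diff_le; try (now apply continuous_bernoulli_integrand).
  intros s Hs. rewrite <- Rmult_minus_distr_l, Rabs_mult.
  apply Rle_trans with (1 * eps); [|lra].
  apply Rmult_le_compat; try apply Rabs_pos; [apply Rabs_le; lra|].
  apply H1; [exact Hx|]. replace (s + y - (s + y')) with (y - y') by ring. exact Hy.
Qed.

Lemma unif2_partial_mean (g : R -> R -> R) :
  unif2 g -> unif2 (fun x _ => RInt (g x) 0 1).
Proof.
  intros Ug eps Heps. destruct (Ug eps Heps) as [d [Hd H1]]. exists d. split; [exact Hd|].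
  intros x _ x' _ Hx _.
  apply RInt_diff_le; try (intros; now apply unif2_continuous_r).
  intros s _. apply H1; [exact Hx|]. rewrite Rminus_eq_0, Rabs_R0. lra.
Qed.

Lemma unif2_minus (f g : R -> R -> R) : unif2 f -> unif2 g -> unif2 (fun x y => f x y - g x y).
Proof.
  intros Uf Ug eps Heps.
  destruct (Uf (eps / 2) ltac:(lra)) as [d [Hd H1]].
  destruct (Ug (eps / 2) ltac:(lra)) as [e [He H2]].
  exists (Rmin d e). split; [apply Rmin_glb_lt; lra|].
  assert (M1 := Rmin_l d e). assert (M2 := Rmin_r d e).
  intros x y x' y' Hx Hy.
  replace (f x y - g x y - (f x' y' - g x' y')) with ((f x y - f x' y') - (g x y - g x' y')) by ring.
  eapply Rle_trans; [apply Rabs_triang|]. rewrite Rabs_Ropp.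
  assert (Rabs (f x y - f x' y') <= eps / 2) by (apply H1; lra).
  assert (Rabs (g x y - g x' y') <= eps / 2) by (apply H2; lra). lra.
Qed.

(** With [a = k = w] this is the [x]-derivative of a window average. *)
Lemma unif2_translate (a k : R) (f : R -> R -> R) :
  unif2 f -> unif2 (fun x y => (f (x + a) y - f x y) / k).
Proof.
  intros Uf eps Heps.
  assert (Hk : 0 < Rabs (/ k) + 1) by (assert (H := Rabs_pos (/ k)); lra).
  assert (He : 0 < eps / (2 * (Rabs (/ k) + 1))) by (apply Rdiv_lt_0_compat; lra).
  destruct (Uf _ He) as [d [Hd H1]]. exists d. split; [exact Hd|].
  intros x y x' y' Hx Hy.
  replace ((f (x + a) y - f x y) / k - (f (x' + a) y' - f x' y') / k)
    with (/ k * ((f (x + a) y - f (x' + a) y') - (f x y - f x' y'))) by (unfold Rdiv; ring).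
  rewrite Rabs_mult.
  apply Rle_trans with ((Rabs (/ k) + 1) * (2 * (eps / (2 * (Rabs (/ k) + 1))))); [|right; field; lra].
  apply Rmult_le_compat; try apply Rabs_pos; [lra|].
  eapply Rle_trans; [apply Rabs_triang|]. rewrite Rabs_Ropp.
  assert (Rabs (f (x + a) y - f (x' + a) y') <= eps / (2 * (Rabs (/ k) + 1))).
  { apply H1; [|exact Hy]. replace (x + a - (x' + a)) with (x - x') by ring. exact Hx. }
  assert (Rabs (f x y - f x' y') <= eps / (2 * (Rabs (/ k) + 1))) by (apply H1; assumption). lra.
Qed.

Lemma bernoulli_conv_periodic (f : R -> R) (y : R) :
  (forall x, f (x + 1) = f x) -> bernoulli_conv f (y + 1) = bernoulli_conv f y.
Proof.
  intros Hf. apply RInt_ext. intros s _. rewrite <- Rplus_assoc, Hf. reflexivity.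
Qed.

(* [P] depends on [x] only and absorbs the mean of [g] over vertical lines; [Q] is averaged in [x]
   because it would otherwise fail to be differentiable in that variable. *)
Lemma potential_exists (g : R -> R -> R) (c eps : R) :
  unif2 g -> (forall x y, g (x + 1) y = g x y) -> (forall x y, g x (y + 1) = g x y) ->
  (forall x y, Rabs (g x y) <= c) -> RInt (fun x => RInt (g x) 0 1) 0 1 = 0 -> 0 < eps ->
  exists P Px Py Q Qx Qy : R -> R -> R,
    strict_diff P Px Py /\ strict_diff Q Qx Qy /\
    (forall x y, Rabs (Px x y + Qy x y - g x y) <= eps) /\
    (forall x y, Rabs (P x y) <= c / 4) /\ (forall x y, Rabs (Q x y) <= c / 4) /\
    (forall x y (m n : Z), P (x + IZR m) (y + IZR n) = P x y) /\
    (forall x y (m n : Z), Q (x + IZR m) (y + IZR n) = Q x y).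
Proof.
  intros Ug gx gy gc gmean Heps.
  set (gbar := fun x => RInt (g x) 0 1).
  assert (Ub : unif2 (fun x _ => gbar x)) by (now apply unif2_partial_mean).
  assert (Cg : forall x y, continuous (g x) y) by (intros; now apply unif2_continuous_r).
  assert (Cb : forall x, continuous gbar x).
  { intros x. exact (unif2_continuous_l _ x 0 Ub). }
  assert (bper : forall x, gbar (x + 1) = gbar x).
  { intros x. apply RInt_ext. intros; apply gx. }
  assert (bc : forall x, Rabs (gbar x) <= c) by (intros; now apply RInt_unit_bound).
  set (q := fun x y => g x y - gbar x).
  assert (Uq : unif2 q) by (now apply unif2_minus).
  (* The kernel has mean zero, so [g x] and [q x] have the same convolution; written with [g x] it
     is bounded by [c / 4], where the bound [2 c] on [q] would give only [c / 2]. *)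
  set (Q0 := fun x y => bernoulli_conv (g x) y).
  assert (UQ0 : unif2 Q0) by (now apply unif2_bernoulli_conv).
  assert (DQ0 : forall x y, is_derive (Q0 x) y (q x y)) by (intros; now apply is_derive_bernoulli_conv).
  (* The window is a modulus of continuity of [q]: averaging [q] over it changes [q] by at most
     [eps], which is the whole error in the divergence. *)
  destruct (Uq eps Heps) as [w [Hw Hwq]].
  exists (fun x _ => bernoulli_conv gbar x), (fun x _ => gbar x), (fun _ _ => 0).
  exists (fun x y => window_avg w (fun t => Q0 t y) x), (fun x y => (Q0 (x + w) y - Q0 x y) / w),
    (fun x y => window_avg w (fun t => q t y) x).
  split; [|split; [|split; [|split; [|split; [|split]]]]].
  - apply strict_diff_of_partials.
    + intros x _. assert (H := is_derive_bernoulli_conv gbar x Cb bper).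
      rewrite (gmean : RInt gbar 0 1 = 0), Rminus_0_r in H. exact H.
    + intros x y. exact (is_derive_const (K := R_AbsRing) (V := R_NormedModule) (bernoulli_conv gbar x) y).
    + exact Ub.
    + intros e He. exists 1. split; [lra|]. intros. rewrite Rminus_eq_0, Rabs_R0. lra.
  - apply strict_diff_of_partials.
    + intros x y. apply (is_derive_window_avg w (fun t => Q0 t y) x Hw).
      intros t. now apply unif2_continuous_l.
    + intros x y. now apply is_derive_window_avg_param.
    + now apply unif2_translate.
    + now apply unif2_window_avg.
  - intros x y.
    replace (gbar x + window_avg w (fun t => q t y) x - g x y)
      with (window_avg w (fun t => q t y) x - RInt (fun _ : R => q x y) 0 1).
    2: { rewrite RInt_const. unfold q at 2. unfold scal; simpl; unfold mult; simpl. ring. }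
    apply RInt_diff_le.
    + apply (continuous_affine (fun t => q t y)). intros; now apply unif2_continuous_l.
    + intros t. apply continuous_const.
    + intros s Hs. apply Hwq.
      * replace (w * s + x - x) with (w * s) by ring. rewrite Rabs_pos_eq by nra. nra.
      * rewrite Rminus_eq_0, Rabs_R0. lra.
  - intros x _. now apply bernoulli_conv_bound.
  - intros x y. apply RInt_unit_bound.
    + apply (continuous_affine (fun t => Q0 t y)). intros; now apply unif2_continuous_l.
    + intros s. apply bernoulli_conv_bound; auto.
  - intros x y m n. apply (periodic_IZR (fun x => bernoulli_conv gbar x)).
    intros; now apply bernoulli_conv_periodic.
  - intros x y m n.
    assert (Qx : forall x y, Q0 (x + 1) y = Q0 x y).
    { intros a b. apply RInt_ext. intros. now rewrite gx. }
    assert (Qy : forall x y, Q0 x (y + 1) = Q0 x y).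
    { intros. now apply bernoulli_conv_periodic. }
    apply RInt_ext. intros s _.
    rewrite (periodic_IZR (fun y => Q0 _ y) (Qy _)).
    rewrite <- Rplus_assoc. apply (periodic_IZR (fun x => Q0 x y)). auto.
Qed.

(** * Minimising polygons *)

Definition energy (N : nat) (x y : Z -> R) : R :=
  INR N * zsum (fun i => fwd x i ^ 2 + fwd y i ^ 2) N.

(** The sign follows [area]: [u . i u' = y x' - x y'], which makes counterclockwise polygons
    negative. *)
Definition polygon_area (N : nat) (x y : Z -> R) : R :=
  / 2 * zsum (fun i => y i * fwd x i - x i * fwd y i) N.

Definition flux (P Q : R -> R -> R) (N : nat) (x y : Z -> R) : R :=
  zsum (fun i => P (x i) (y i) * ctr y i - Q (x i) (y i) * ctr x i) N.

Definition objective (P Q : R -> R -> R) (N : nat) (x y : Z -> R) : R :=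
  sqrt (energy N x y) - flux P Q N x y.

Lemma energy_nonneg (N : nat) (x y : Z -> R) : 0 <= energy N x y.
Proof.
  apply Rmult_le_pos; [apply pos_INR|]. apply zsum_nonneg. intros i.
  assert (H1 := pow2_ge_0 (fwd x i)). assert (H2 := pow2_ge_0 (fwd y i)). lra.
Qed.

Lemma energy_sym (N : nat) (x y : Z -> R) : energy N x y = energy N y x.
Proof. unfold energy. f_equal. apply zsum_ext. intros; ring. Qed.

Lemma variation_le_length (N : nat) (x y : Z -> R) :
  zsum (fun i => Rabs (fwd x i)) N <= sqrt (energy N x y).
Proof.
  rewrite <- (sqrt_pow2 (zsum (fun i => Rabs (fwd x i)) N)).
  2: { apply zsum_nonneg. intros; apply Rabs_pos. }
  apply sqrt_le_1_alt. eapply Rle_trans; [apply zsum_cauchy_schwarz_1|].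
  apply Rmult_le_compat_l; [apply pos_INR|]. apply zsum_le. intros i _.
  rewrite pow2_abs. assert (H := pow2_ge_0 (fwd y i)). lra.
Qed.

Lemma distance_le_length (N : nat) (x y : Z -> R) (i : Z) :
  (0 <= i < Z.of_nat N)%Z -> Rabs (x i - x 0%Z) <= sqrt (energy N x y).
Proof.
  intros Hi. eapply Rle_trans; [now apply (zsum_variation x N)|]. apply variation_le_length.
Qed.

(** A crude isoperimetric inequality: with vertex 0 moved to the origin, coordinates and total
    variations are all at most [l], the square root of the energy. It keeps the energy away from
    zero at prescribed area. *)
Lemma polygon_area_le_energy (N : nat) (x y : Z -> R) :
  periodic N x -> periodic N y -> Rabs (polygon_area N x y) <= energy N x y.
Proof.
  intros Px Py. set (l := sqrt (energy N x y)).
  assert (Hl : 0 <= l) by apply sqrt_pos.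
  assert (Hxx : zsum (fun i => Rabs (fwd x i)) N <= l) by apply variation_le_length.
  assert (Hyy : zsum (fun i => Rabs (fwd y i)) N <= l).
  { unfold l. rewrite energy_sym. apply variation_le_length. }
  assert (E : polygon_area N x y
     = / 2 * zsum (fun i => (y i - y 0%Z) * fwd x i - (x i - x 0%Z) * fwd y i) N).
  { unfold polygon_area. f_equal.
    transitivity (zsum (fun i => y i * fwd x i - x i * fwd y i) N
       - y 0%Z * zsum (fwd x) N + x 0%Z * zsum (fwd y) N).
    - rewrite !zsum_fwd. rewrite <- (Z.add_0_l (Z.of_nat N)), (Px 0%Z), (Py 0%Z). ring.
    - rewrite <- !zsum_scal, <- zsum_minus, <- zsum_plus. apply zsum_ext. intros; ring. }
  rewrite E, Rabs_mult, (Rabs_pos_eq (/ 2)) by lra.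
  replace (energy N x y) with (l * l) by (apply sqrt_sqrt, energy_nonneg).
  assert (H : zsum (fun i => Rabs ((y i - y 0%Z) * fwd x i - (x i - x 0%Z) * fwd y i)) N
     <= l * zsum (fun i => Rabs (fwd x i)) N + l * zsum (fun i => Rabs (fwd y i)) N).
  { rewrite <- !zsum_scal, <- zsum_plus. apply zsum_le. intros i Hi.
    eapply Rle_trans; [apply Rabs_triang|]. rewrite Rabs_Ropp, !Rabs_mult.
    apply Rplus_le_compat; apply Rmult_le_compat_r; try apply Rabs_pos.
    - unfold l. rewrite energy_sym. now apply distance_le_length.
    - now apply distance_le_length. }
  assert (H2 := zsum_abs (fun i => (y i - y 0%Z) * fwd x i - (x i - x 0%Z) * fwd y i) N).
  nra.
Qed.

(** A central difference is the average of two forward ones, and squaring is convex. *)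
Lemma ctr_sq_le (f : Z -> R) (i : Z) : ctr f i ^ 2 <= (fwd f i ^ 2 + fwd f (i - 1)%Z ^ 2) / 2.
Proof.
  unfold ctr, fwd. replace (i - 1 + 1)%Z with i by lia.
  assert (H := pow2_ge_0 (f (i + 1)%Z - 2 * f i + f (i - 1)%Z)). nra.
Qed.

Lemma ctr_sq_sum_le (N : nat) (x y : Z -> R) : periodic N x -> periodic N y ->
  zsum (fun i => ctr x i ^ 2 + ctr y i ^ 2) N <= zsum (fun i => fwd x i ^ 2 + fwd y i ^ 2) N.
Proof.
  intros Px Py. set (e := fun i => fwd x i ^ 2 + fwd y i ^ 2).
  assert (He : periodic N e).
  { intros i. unfold e. now rewrite (periodic_fwd N x Px i), (periodic_fwd N y Py i). }
  apply Rle_trans with (/ 2 * (zsum e N + zsum (fun i => e (i - 1)%Z) N)).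
  - rewrite <- zsum_plus, <- zsum_scal. apply zsum_le. intros i _. unfold e.
    assert (H1 := ctr_sq_le x i). assert (H2 := ctr_sq_le y i). lra.
  - rewrite (zsum_pred N e He). lra.
Qed.

Section Minimisation.
Variables (P Q : R -> R -> R) (b k : R).
Hypothesis P_bound : forall x y, Rabs (P x y) <= b.
Hypothesis Q_bound : forall x y, Rabs (Q x y) <= b.
Hypothesis k_pos : 0 < k.
Hypothesis b_le_k : 2 * b ^ 2 <= k ^ 2.

(** [b_le_k] bounds the length of [(P, Q)] by [k], so each term is at most [k] times the length of
    the central difference. Young's inequality with weight [t] replaces that length by its square,
    which sums to at most the energy divided by [N]. *)
Lemma flux_bound (N : nat) (x y : Z -> R) :
  (0 < N)%nat -> periodic N x -> periodic N y -> 0 < energy N x y ->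
  Rabs (flux P Q N x y) <= k * sqrt (energy N x y).
Proof.
  intros HN Px Py HE. set (l := sqrt (energy N x y)).
  assert (Hl : 0 < l) by (apply sqrt_lt_R0; exact HE).
  assert (HNR : 0 < INR N) by (apply lt_0_INR; exact HN).
  (* The weight that balances Young's inequality: both resulting sums are at most [k / 2 * l]. *)
  set (t := l / INR N). assert (Ht : 0 < t) by (apply Rdiv_lt_0_compat; lra).
  unfold flux. eapply Rle_trans; [apply zsum_abs|].
  apply Rle_trans with (zsum (fun i => k / 2 * t + k / (2 * t) * (ctr x i ^ 2 + ctr y i ^ 2)) N).
  - apply zsum_le. intros i _.
    set (p := P (x i) (y i)). set (q := Q (x i) (y i)). set (dx := ctr x i). set (dy := ctr y i).
    set (u := dx ^ 2 + dy ^ 2).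
    assert (Hu : 0 <= u) by (unfold u; assert (H1 := pow2_ge_0 dx); assert (H2 := pow2_ge_0 dy); lra).
    assert (Hp : p ^ 2 <= b ^ 2).
    { apply pow_maj_Rabs, P_bound. }
    assert (Hq : q ^ 2 <= b ^ 2).
    { apply pow_maj_Rabs, Q_bound. }
    assert (Hs : (p * dy - q * dx) ^ 2 <= k ^ 2 * u).
    { apply Rle_trans with ((p ^ 2 + q ^ 2) * u).
      - assert (H := pow2_ge_0 (p * dx + q * dy)). unfold u. nra.
      - apply Rmult_le_compat_r; lra. }
    assert (Hz : 0 <= k / 2 * t + k / (2 * t) * u).
    { assert (0 < k / (2 * t)) by (apply Rdiv_lt_0_compat; lra).
      assert (0 <= k / (2 * t) * u) by (apply Rmult_le_pos; lra).
      assert (0 < k / 2 * t) by (apply Rmult_lt_0_compat; lra). lra. }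
    rewrite <- (Rabs_pos_eq (k / 2 * t + k / (2 * t) * u)) by exact Hz.
    apply Rsqr_le_abs_0. rewrite !Rsqr_pow2.
    eapply Rle_trans; [exact Hs|].
    replace (k ^ 2 * u) with (k ^ 2 * (4 * (t / 2 * (u / (2 * t))))) by (field; lra).
    replace ((k / 2 * t + k / (2 * t) * u) ^ 2) with (k ^ 2 * (t / 2 + u / (2 * t)) ^ 2) by (field; lra).
    apply Rmult_le_compat_l; [apply pow2_ge_0|].
    assert (H := pow2_ge_0 (t / 2 - u / (2 * t))). nra.
  - rewrite zsum_plus, zsum_const, zsum_scal.
    assert (H1 := ctr_sq_sum_le N x y Px Py).
    assert (Hk2 : 0 < k / (2 * t)) by (apply Rdiv_lt_0_compat; lra).
    apply (Rmult_le_compat_l (k / (2 * t))) in H1; [|lra].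
    replace (k / (2 * t) * zsum (fun i => fwd x i ^ 2 + fwd y i ^ 2) N) with (k / 2 * l) in H1.
    2: { transitivity (k / (2 * t) * (energy N x y / INR N)).
         - replace (energy N x y) with (l * l) by (apply sqrt_sqrt; lra).
           unfold t. field. lra.
         - unfold energy. field. lra. }
    replace (INR N * (k / 2 * t)) with (k / 2 * l) by (unfold t; field; lra). lra.
Qed.

Lemma objective_lower (N : nat) (x y : Z -> R) :
  (0 < N)%nat -> periodic N x -> periodic N y -> 0 < energy N x y ->
  (1 - k) * sqrt (energy N x y) <= objective P Q N x y.
Proof.
  intros HN Px Py HE. assert (H := flux_bound N x y HN Px Py HE).
  apply Rabs_le_between in H. unfold objective. lra.
Qed.

Lemma objective_upper (N : nat) (x y : Z -> R) :
  (0 < N)%nat -> periodic N x -> periodic N y -> 0 < energy N x y ->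
  objective P Q N x y <= (1 + k) * sqrt (energy N x y).
Proof.
  intros HN Px Py HE. assert (H := flux_bound N x y HN Px Py HE).
  apply Rabs_le_between in H. unfold objective. lra.
Qed.

Hypothesis P_periodic : forall x y (m n : Z), P (x + IZR m) (y + IZR n) = P x y.
Hypothesis Q_periodic : forall x y (m n : Z), Q (x + IZR m) (y + IZR n) = Q x y.

Lemma fwd_translate (x : Z -> R) (m : R) (i : Z) : fwd (fun j => x j + m) i = fwd x i.
Proof. unfold fwd. ring. Qed.

Lemma objective_translate (N : nat) (x y : Z -> R) (m n : Z) :
  objective P Q N (fun i => x i + IZR m) (fun i => y i + IZR n) = objective P Q N x y.
Proof.
  unfold objective, energy, flux. f_equal; [f_equal; f_equal|]; apply zsum_ext; intros i.
  - now rewrite !fwd_translate.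
  - rewrite P_periodic, Q_periodic. unfold ctr. field.
Qed.

Lemma polygon_area_translate (N : nat) (x y : Z -> R) (m n : R) :
  periodic N x -> periodic N y ->
  polygon_area N (fun i => x i + m) (fun i => y i + n) = polygon_area N x y.
Proof.
  intros Px Py. unfold polygon_area. f_equal.
  transitivity (zsum (fun i => y i * fwd x i - x i * fwd y i) N
       + n * zsum (fwd x) N - m * zsum (fwd y) N).
  - rewrite <- !zsum_scal, <- zsum_plus, <- zsum_minus. apply zsum_ext. intros i.
    rewrite !fwd_translate. ring.
  - rewrite !zsum_fwd, <- (Z.add_0_l (Z.of_nat N)), (Px 0%Z), (Py 0%Z). ring.
Qed.

Lemma energy_pos_of_area (N : nat) (x y : Z -> R) (a : R) : a <> 0 ->
  periodic N x -> periodic N y -> polygon_area N x y = a -> 0 < energy N x y.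
Proof.
  intros Ha Px Py HA. assert (H := polygon_area_le_energy N x y Px Py).
  rewrite HA in H. assert (H1 := Rabs_pos_lt a Ha). lra.
Qed.

(** Stated along an arbitrary filter on [nat], ready for ultralimits. *)
Definition continuous_seq2 (f : R -> R -> R) : Prop :=
  forall (F : (nat -> Prop) -> Prop), Filter F -> forall (u v : nat -> R) (x y : R),
  filterlim u F (locally x) -> filterlim v F (locally y) ->
  filterlim (fun n => f (u n) (v n)) F (locally (f x y)).

Hypothesis P_cont : continuous_seq2 P.
Hypothesis Q_cont : continuous_seq2 Q.
Hypothesis k_lt_1 : k < 1.

(** The direct method at fixed [N]. As [k < 1], a minimising sequence has bounded energy; integer
    translations put vertex 0 into the unit square, so all vertices stay bounded and converge one by
    one. *)
Lemma minimiser_exists (N : nat) (a : R) (x0 y0 : Z -> R) :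
  (0 < N)%nat -> a <> 0 -> periodic N x0 -> periodic N y0 -> polygon_area N x0 y0 = a ->
  exists x y, periodic N x /\ periodic N y /\ polygon_area N x y = a /\
    Rabs (x 0%Z) <= 1 /\ Rabs (y 0%Z) <= 1 /\
    forall x' y', periodic N x' -> periodic N y' -> polygon_area N x' y' = a ->
      objective P Q N x y <= objective P Q N x' y'.
Proof.
  intros HN Ha Px0 Py0 HA0.
  (* The objective is negated because [completeness] provides suprema. *)
  set (S := fun r => exists x y, periodic N x /\ periodic N y /\ polygon_area N x y = a /\
    Rabs (x 0%Z) <= 1 /\ Rabs (y 0%Z) <= 1 /\ r = - objective P Q N x y).
  assert (Hnorm : forall x y, periodic N x -> periodic N y -> polygon_area N x y = a ->
     S (- objective P Q N x y)).
  { intros x y Px Py HA.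
    exists (fun i => x i + IZR (- Int_part (x 0%Z))), (fun i => y i + IZR (- Int_part (y 0%Z))).
    split; [intros i; now rewrite Px|]. split; [intros i; now rewrite Py|].
    split; [now rewrite polygon_area_translate|].
    destruct (base_Int_part (x 0%Z)). destruct (base_Int_part (y 0%Z)).
    rewrite !opp_IZR. split; [apply Rabs_le; lra|split; [apply Rabs_le; lra|]].
    now rewrite <- !opp_IZR, objective_translate. }
  destruct (completeness S) as [m [Hm1 Hm2]].
  { exists 0. intros r [x [y [Px [Py [HA [_ [_ Hr]]]]]]]. subst r.
    assert (HE := energy_pos_of_area N x y a Ha Px Py HA).
    assert (H := objective_lower N x y HN Px Py HE).
    assert (0 <= (1 - k) * sqrt (energy N x y)) by (apply Rmult_le_pos; [lra|apply sqrt_pos]). lra. }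
  { eexists. apply (Hnorm x0 y0); assumption. }
  assert (Hseq : forall n : nat, exists xy : (Z -> R) * (Z -> R),
    periodic N (fst xy) /\ periodic N (snd xy) /\ polygon_area N (fst xy) (snd xy) = a /\
    Rabs (fst xy 0%Z) <= 1 /\ Rabs (snd xy 0%Z) <= 1 /\
    - m <= objective P Q N (fst xy) (snd xy) <= - m + / (INR n + 1)).
  { intros n. assert (Hn : 0 < / (INR n + 1)) by (apply Rinv_0_lt_compat; assert (H := pos_INR n); lra).
    apply NNPP. intros Hno. assert (m <= m - / (INR n + 1)); [|lra].
    apply Hm2. intros r Hr. apply Rnot_lt_le. intros Hlt. apply Hno.
    assert (Hrm := Hm1 r Hr).
    destruct Hr as [x [y [Px [Py [HA [Hx [Hy Hr]]]]]]]. exists (x, y). simpl.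
    repeat split; try assumption; lra. }
  apply choice in Hseq. destruct Hseq as [s Hs].
  destruct ultrafilter_nat_exists as [U [HU [ultra Uev]]].
  (* [(1 - k)] times the root of the energy is at most the objective, which is at most [- m + 1]
     along the sequence. *)
  set (B := (- m + 1) / (1 - k)).
  assert (HB : forall n, sqrt (energy N (fst (s n)) (snd (s n))) <= B).
  { intros n. destruct (Hs n) as [Px [Py [HA [_ [_ [_ Hm]]]]]].
    assert (HE := energy_pos_of_area N _ _ a Ha Px Py HA).
    assert (H := objective_lower N _ _ HN Px Py HE).
    assert (Hn : / (INR n + 1) <= 1).
    { rewrite <- Rinv_1. apply Rinv_le_contravar; [lra|]. assert (H0 := pos_INR n). lra. }
    apply (Rmult_le_reg_l (1 - k)); [lra|].
    replace ((1 - k) * B) with (- m + 1) by (unfold B; field; lra). lra. }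
  assert (Hbx : forall n i, Rabs (fst (s n) i) <= 1 + B).
  { intros n. destruct (Hs n) as [Px [Py [HA [Hx [Hy Hm]]]]].
    apply (periodic_forall N (fst (s n)) (fun r => Rabs r <= 1 + B) HN Px). intros i Hi.
    assert (H := distance_le_length N (fst (s n)) (snd (s n)) i Hi).
    replace (fst (s n) i) with (fst (s n) 0%Z + (fst (s n) i - fst (s n) 0%Z)) by ring.
    eapply Rle_trans; [apply Rabs_triang|]. specialize (HB n). lra. }
  assert (Hby : forall n i, Rabs (snd (s n) i) <= 1 + B).
  { intros n. destruct (Hs n) as [Px [Py [HA [Hx [Hy Hm]]]]].
    apply (periodic_forall N (snd (s n)) (fun r => Rabs r <= 1 + B) HN Py). intros i Hi.
    assert (H := distance_le_length N (snd (s n)) (fst (s n)) i Hi).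
    rewrite energy_sym in H.
    replace (snd (s n) i) with (snd (s n) 0%Z + (snd (s n) i - snd (s n) 0%Z)) by ring.
    eapply Rle_trans; [apply Rabs_triang|]. specialize (HB n). lra. }
  destruct (choice (fun i l => filterlim (fun n => fst (s n) i) U (locally l))) as [x Hx].
  { intros i. apply (ultralimit_bounded_exists U _ (1 + B) HU ultra). now apply filter_forall. }
  destruct (choice (fun i l => filterlim (fun n => snd (s n) i) U (locally l))) as [y Hy].
  { intros i. apply (ultralimit_bounded_exists U _ (1 + B) HU ultra). now apply filter_forall. }
  assert (Hfx : forall i, filterlim (fun n => fwd (fst (s n)) i) U (locally (fwd x i))).
  { intros i. apply filterlim_Rminus; apply Hx. }
  assert (Hfy : forall i, filterlim (fun n => fwd (snd (s n)) i) U (locally (fwd y i))).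
  { intros i. apply filterlim_Rminus; apply Hy. }
  assert (Hcx : forall i, filterlim (fun n => ctr (fst (s n)) i) U (locally (ctr x i))).
  { intros i. apply filterlim_Rmult; [|apply filterlim_const]. apply filterlim_Rminus; apply Hx. }
  assert (Hcy : forall i, filterlim (fun n => ctr (snd (s n)) i) U (locally (ctr y i))).
  { intros i. apply filterlim_Rmult; [|apply filterlim_const]. apply filterlim_Rminus; apply Hy. }
  assert (Px : periodic N x).
  { intros i. apply (filterlim_Runique (F := U) (fun n => fst (s n) i)); [|apply Hx].
    eapply filterlim_ext; [|apply (Hx (i + Z.of_nat N)%Z)]. intros n. simpl. apply (Hs n). }
  assert (Py : periodic N y).
  { intros i. apply (filterlim_Runique (F := U) (fun n => snd (s n) i)); [|apply Hy].
    eapply filterlim_ext; [|apply (Hy (i + Z.of_nat N)%Z)]. intros n. simpl. apply (Hs n). }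
  assert (HA : polygon_area N x y = a).
  { apply (filterlim_Runique (F := U) (fun n => polygon_area N (fst (s n)) (snd (s n)))).
    - apply filterlim_Rmult; [apply filterlim_const|].
      apply (filterlim_zsum (fun n i => snd (s n) i * fwd (fst (s n)) i - fst (s n) i * fwd (snd (s n)) i)).
      intros i. apply filterlim_Rminus; apply filterlim_Rmult; auto.
    - eapply filterlim_ext; [|apply filterlim_const]. intros n. simpl. symmetry. apply (Hs n). }
  assert (HE : filterlim (fun n => sqrt (energy N (fst (s n)) (snd (s n)))) U
     (locally (sqrt (energy N x y)))).
  { eapply filterlim_comp; [|apply (continuous_sqrt (energy N x y))].
    apply filterlim_Rmult; [apply filterlim_const|].
    apply (filterlim_zsum (fun n i => fwd (fst (s n)) i ^ 2 + fwd (snd (s n)) i ^ 2)).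
    intros i. simpl. apply filterlim_Rplus; apply filterlim_Rmult; auto;
    apply filterlim_Rmult; auto; apply filterlim_const. }
  assert (HJ : filterlim (fun n => objective P Q N (fst (s n)) (snd (s n))) U
     (locally (objective P Q N x y))).
  { apply filterlim_Rminus; [exact HE|].
    apply (filterlim_zsum (fun n i => P (fst (s n) i) (snd (s n) i) * ctr (snd (s n)) i
       - Q (fst (s n) i) (snd (s n) i) * ctr (fst (s n)) i)).
    intros i. apply filterlim_Rminus; apply filterlim_Rmult; auto.
    - apply P_cont; auto. apply filter_filter.
    - apply Q_cont; auto. apply filter_filter. }
  exists x, y. split; [exact Px|]. split; [exact Py|]. split; [exact HA|].
  split; [|split].
  - apply (filterlim_Rle (F := U) (fun n => Rabs (fst (s n) 0%Z)) (fun _ => 1)).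
    + apply filter_forall. intros n. apply (Hs n).
    + eapply filterlim_comp; [apply Hx|apply (continuous_Rabs (x 0%Z))].
    + apply filterlim_const.
  - apply (filterlim_Rle (F := U) (fun n => Rabs (snd (s n) 0%Z)) (fun _ => 1)).
    + apply filter_forall. intros n. apply (Hs n).
    + eapply filterlim_comp; [apply Hy|apply (continuous_Rabs (y 0%Z))].
    + apply filterlim_const.
  - assert (Hinv : filterlim (fun n => / (INR n + 1)) U (locally 0)).
    { apply filterlim_Rabs_le. intros eps Heps. apply Uev.
      destruct (nfloor_ex (/ eps)) as [K HK]; [apply Rlt_le, Rinv_0_lt_compat; lra|].
      exists K. intros n Hn. apply le_INR in Hn.
      assert (Hi : 0 < / eps) by (apply Rinv_0_lt_compat; lra).
      rewrite Rminus_0_r, Rabs_pos_eq.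
      - rewrite <- (Rinv_inv eps). apply Rinv_le_contravar; lra.
      - apply Rlt_le, Rinv_0_lt_compat. lra. }
    assert (HJm : objective P Q N x y <= - m).
    { replace (- m) with (- m + 0) by ring.
      apply (filterlim_Rle (F := U) (fun n => objective P Q N (fst (s n)) (snd (s n)))
        (fun n => - m + / (INR n + 1))).
      - apply filter_forall. intros n. apply (Hs n).
      - exact HJ.
      - apply filterlim_Rplus; [apply filterlim_const|exact Hinv]. }
    intros x' y' Px' Py' HA'. assert (H := Hm1 _ (Hnorm x' y' Px' Py' HA')). lra.
Qed.

End Minimisation.

(** A competitor with energy bounded independently of [N]. With [h = PI / N] its energy is
    [4 |a| N tan h], and [tan h <= 2 h] because [cos h >= 1/2] once [N >= 3]. *)
Lemma regular_polygon_exists (N : nat) (a : R) : (3 <= N)%nat -> a <> 0 ->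
  exists x y, periodic N x /\ periodic N y /\ polygon_area N x y = a /\
    energy N x y <= 8 * PI * Rabs a.
Proof.
  intros HN Ha.
  assert (HNR : 3 <= INR N) by (apply le_INR in HN; simpl in HN; lra).
  assert (HPI := PI_RGT_0).
  set (h := PI / INR N).
  assert (Hh : 0 < h) by (apply Rdiv_lt_0_compat; lra).
  assert (Hh3 : h <= PI / 3).
  { apply Rmult_le_compat_l; [lra|]. apply Rinv_le_contravar; lra. }
  assert (Hsin : 0 < sin h) by (apply sin_gt_0; lra).
  assert (Hcos : / 2 <= cos h).
  { rewrite <- (Rmult_1_l (/ 2)). fold (1 / 2). rewrite <- cos_PI3. apply cos_decr_1; lra. }
  assert (Hsh : sin h <= h) by (apply Rlt_le, sin_lt_x; lra).
  (* The sign of [a]. It enters [y] with a minus, since positive area means clockwise traversal. *)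
  set (e := a / Rabs a).
  assert (Haa : 0 < Rabs a) by (apply Rabs_pos_lt; exact Ha).
  assert (He2 : e * e = 1).
  { unfold e. replace (a / Rabs a * (a / Rabs a)) with ((a * a) / (Rabs a * Rabs a)) by (field; lra).
    rewrite <- Rabs_mult, (Rabs_pos_eq (a * a)) by nra. field. exact Ha. }
  assert (Hea : e * Rabs a = a) by (unfold e; field; lra).
  (* Squared circumradius: a regular polygon of circumradius [r] encloses [N r^2 sin h cos h]. *)
  set (R2 := Rabs a / (INR N * (sin h * cos h))).
  assert (HR2 : 0 < R2).
  { apply Rdiv_lt_0_compat; [exact Haa|]. apply Rmult_lt_0_compat; [lra|]. apply Rmult_lt_0_compat; lra. }
  set (r := sqrt R2). assert (Hr : r * r = R2) by (apply sqrt_sqrt; lra).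
  set (x := fun i : Z => r * cos (2 * h * IZR i)).
  set (y := fun i : Z => - e * (r * sin (2 * h * IZR i))).
  assert (Hang : forall i : Z, 2 * h * IZR (i + Z.of_nat N) = 2 * h * IZR i + 2 * PI).
  { intros i. rewrite plus_IZR, <- INR_IZR_INZ. unfold h. field. lra. }
  assert (Hnext : forall i : Z, 2 * h * IZR (i + 1) = 2 * h * IZR i + 2 * h).
  { intros i. rewrite plus_IZR. ring. }
  exists x, y. split; [|split; [|split]].
  - intros i. unfold x. rewrite Hang. replace (2 * PI) with (2 * INR 1 * PI) by (simpl; ring).
    now rewrite cos_period.
  - intros i. unfold y. rewrite Hang. replace (2 * PI) with (2 * INR 1 * PI) by (simpl; ring).
    now rewrite sin_period.
  - unfold polygon_area.
    rewrite (zsum_ext _ (fun _ => e * R2 * (2 * sin h * cos h))).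
    + rewrite zsum_const. rewrite <- Hea. unfold R2. field. lra.
    + intros i. unfold fwd, x, y. rewrite Hnext.
      replace (2 * sin h * cos h) with (sin (2 * h)) by apply sin_2a.
      set (t := 2 * h * IZR i). rewrite cos_plus, sin_plus.
      assert (H1 := sin2_cos2 t). unfold Rsqr in H1.
      transitivity (e * (r * r) * sin (2 * h) * (sin t * sin t + cos t * cos t)); [ring|].
      rewrite H1, Hr. ring.
  - unfold energy.
    rewrite (zsum_ext _ (fun _ => 4 * R2 * (sin h * sin h))).
    + rewrite zsum_const. unfold R2.
      replace (INR N * (INR N * (4 * (Rabs a / (INR N * (sin h * cos h))) * (sin h * sin h))))
        with (4 * Rabs a * (INR N * (sin h / cos h))) by (field; lra).
      replace (8 * PI * Rabs a) with (4 * Rabs a * (INR N * (2 * h))) by (unfold h; field; lra).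
      apply Rmult_le_compat_l; [lra|]. apply Rmult_le_compat_l; [lra|].
      apply (Rmult_le_reg_r (cos h)); [lra|].
      replace (sin h / cos h * cos h) with (sin h) by (field; lra). nra.
    + intros i. unfold fwd, x, y. rewrite Hnext.
      set (t := 2 * h * IZR i). rewrite cos_plus, sin_plus, cos_2a_sin, sin_2a.
      assert (H1 := sin2_cos2 t). assert (H2 := sin2_cos2 h). unfold Rsqr in H1, H2.
      set (S := sin t) in *. set (C := cos t) in *. set (u := sin h) in *. set (v := cos h) in *.
      transitivity (r * r * ((C * (- 2 * u * u) - S * (2 * u * v)) ^ 2
         + (e * e) * (S * (- 2 * u * u) + C * (2 * u * v)) ^ 2)); [ring|].
      rewrite Hr, He2.
      transitivity (4 * R2 * (u * u) * ((S * S + C * C) * (u * u + v * v))); [ring|].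
      rewrite H1, H2. ring.
Qed.

(** * Discrete Euler-Lagrange equations *)

Lemma strict_diff_differentiable (f fx fy : R -> R -> R) (x y : R) :
  strict_diff f fx fy -> differentiable_pt_lim f x y (fx x y) (fy x y).
Proof.
  intros Hf [eps Heps]. destruct (Hf (eps / 2) ltac:(lra)) as [d [Hd H]].
  exists (mkposreal d Hd). simpl. intros u v Hu Hv.
  assert (H0 : Rabs 0 <= d) by (rewrite Rabs_R0; lra).
  assert (H1 := H x y x y u v). rewrite !Rminus_eq_0 in H1.
  eapply Rle_trans; [apply H1; lra|].
  assert (M1 := Rmax_l (Rabs (u - x)) (Rabs (v - y))).
  assert (M2 := Rmax_r (Rabs (u - x)) (Rabs (v - y))). nra.
Qed.

Lemma strict_diff_continuous_seq2 (f fx fy : R -> R -> R) :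
  strict_diff f fx fy -> continuous_seq2 f.
Proof.
  intros Hf F FF u v x y Hu Hv. apply filterlim_Rabs_le. intros eps Heps.
  destruct (Hf 1 ltac:(lra)) as [d [Hd H]].
  set (K := Rabs (fx x y) + Rabs (fy x y) + 2).
  assert (HK : 0 < K).
  { unfold K. assert (H1 := Rabs_pos (fx x y)). assert (H2 := Rabs_pos (fy x y)). lra. }
  set (d' := Rmin d (eps / (2 * K))).
  assert (Hd' : 0 < d') by (apply Rmin_glb_lt; [lra|apply Rdiv_lt_0_compat; lra]).
  generalize (filter_and _ _ (filterlim_Rabs_lt u x d' Hu Hd') (filterlim_Rabs_lt v y d' Hv Hd')).
  apply filter_imp. intros n [H1 H2].
  assert (M1 := Rmin_l d (eps / (2 * K)) : d' <= d).
  assert (M2 := Rmin_r d (eps / (2 * K)) : d' <= eps / (2 * K)).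
  assert (H0 : Rabs 0 <= d) by (rewrite Rabs_R0; lra).
  assert (H3 := H x y x y (u n) (v n)). rewrite !Rminus_eq_0 in H3.
  specialize (H3 H0 H0 ltac:(lra) ltac:(lra)).
  set (p := u n - x) in *. set (q := v n - y) in *.
  replace (f (u n) (v n) - f x y) with
    ((f (u n) (v n) - f x y - (fx x y * p + fy x y * q)) + (fx x y * p + fy x y * q)) by ring.
  eapply Rle_trans; [apply Rabs_triang|].
  assert (H4 : Rabs (fx x y * p + fy x y * q) <= Rabs (fx x y) * Rabs p + Rabs (fy x y) * Rabs q).
  { eapply Rle_trans; [apply Rabs_triang|]. rewrite !Rabs_mult. lra. }
  assert (A1 := Rabs_pos (fx x y)). assert (A2 := Rabs_pos (fy x y)).
  assert (A3 := Rabs_pos p). assert (A4 := Rabs_pos q).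
  apply Rle_trans with (K * (2 * (eps / (2 * K)))); [|right; field; lra].
  unfold K in *. nra.
Qed.

Lemma is_derive_local_min (f : R -> R) (t l : R) :
  is_derive f t l -> locally t (fun s => f t <= f s) -> l = 0.
Proof.
  intros Hf [[d Hd] Hmin]. apply is_derive_Reals in Hf.
  rewrite <- (derive_pt_eq_0 f t l (exist _ l Hf) Hf).
  apply (deriv_minimum f (t - d) (t + d) t); [lra|lra|].
  intros s H1 H2. apply Hmin. change (Rabs (s - t) < d). apply Rabs_def1; lra.
Qed.

Lemma is_derive_fwd (X : R -> Z -> R) (dX : Z -> R) (t : R) (i : Z) :
  (forall i, is_derive (fun s => X s i) t (dX i)) ->
  is_derive (fun s => fwd (X s) i) t (fwd dX i).
Proof. intros H. apply is_derive_Rminus; apply H. Qed.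

Lemma is_derive_ctr (X : R -> Z -> R) (dX : Z -> R) (t : R) (i : Z) :
  (forall i, is_derive (fun s => X s i) t (dX i)) ->
  is_derive (fun s => ctr (X s) i) t (ctr dX i).
Proof.
  intros H. unfold ctr, Rdiv.
  apply (is_derive_ext (fun s => / 2 * (X s (i + 1)%Z - X s (i - 1)%Z))); [intros; apply Rmult_comm|].
  rewrite Rmult_comm. apply (is_derive_scal (fun s => X s (i + 1)%Z - X s (i - 1)%Z)).
  apply is_derive_Rminus; apply H.
Qed.

Section Variation.
Variables (P Px Py Q Qx Qy : R -> R -> R).
Hypothesis P_diff : strict_diff P Px Py.
Hypothesis Q_diff : strict_diff Q Qx Qy.

(** The last term comes from summation by parts. By the chain rule it is nearly
    [Qx ctr x + Qy ctr y], so that [Qx] cancels and [(Px + Qy) ctr y] remains. *)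
Definition flux_grad_x (x y : Z -> R) (i : Z) : R :=
  Px (x i) (y i) * ctr y i - Qx (x i) (y i) * ctr x i + ctr (fun j => Q (x j) (y j)) i.

Definition flux_grad_y (x y : Z -> R) (i : Z) : R :=
  Py (x i) (y i) * ctr y i - Qy (x i) (y i) * ctr x i - ctr (fun j => P (x j) (y j)) i.

Definition objective_grad_x (N : nat) (x y : Z -> R) (i : Z) : R :=
  INR N / sqrt (energy N x y) * (fwd x (i - 1)%Z - fwd x i) - flux_grad_x x y i.

Definition objective_grad_y (N : nat) (x y : Z -> R) (i : Z) : R :=
  INR N / sqrt (energy N x y) * (fwd y (i - 1)%Z - fwd y i) - flux_grad_y x y i.

Lemma periodic_comp2 (N : nat) (f : R -> R -> R) (x y : Z -> R) :
  periodic N x -> periodic N y -> periodic N (fun j => f (x j) (y j)).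
Proof. intros Hx Hy i. now rewrite (Hx i), (Hy i). Qed.

Lemma is_derive_energy (N : nat) (X Y : R -> Z -> R) (dX dY : Z -> R) (t : R) :
  (forall i, is_derive (fun s => X s i) t (dX i)) ->
  (forall i, is_derive (fun s => Y s i) t (dY i)) ->
  is_derive (fun s => energy N (X s) (Y s)) t
    (INR N * zsum (fun i => 2 * fwd (X t) i * fwd dX i + 2 * fwd (Y t) i * fwd dY i) N).
Proof.
  intros HX HY. apply (is_derive_scal (fun s => zsum _ N)).
  apply (is_derive_zsum (fun s i => fwd (X s) i ^ 2 + fwd (Y s) i ^ 2)). intros i.
  apply is_derive_Rplus.
  - replace (2 * fwd (X t) i * fwd dX i) with (INR 2 * fwd dX i * fwd (X t) i ^ pred 2) by (simpl; ring).
    apply (is_derive_pow (fun s => fwd (X s) i)). now apply is_derive_fwd.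
  - replace (2 * fwd (Y t) i * fwd dY i) with (INR 2 * fwd dY i * fwd (Y t) i ^ pred 2) by (simpl; ring).
    apply (is_derive_pow (fun s => fwd (Y s) i)). now apply is_derive_fwd.
Qed.

Lemma is_derive_comp2 (f fx fy : R -> R -> R) (u v : R -> R) (t du dv : R) :
  strict_diff f fx fy -> is_derive u t du -> is_derive v t dv ->
  is_derive (fun s => f (u s) (v s)) t (fx (u t) (v t) * du + fy (u t) (v t) * dv).
Proof.
  intros Hf Hu Hv. apply is_derive_Reals. apply is_derive_Reals in Hu. apply is_derive_Reals in Hv.
  apply derivable_pt_lim_comp_2d; auto. now apply strict_diff_differentiable.
Qed.

Lemma is_derive_flux (N : nat) (X Y : R -> Z -> R) (dX dY : Z -> R) (t : R) :
  periodic N (X t) -> periodic N (Y t) -> periodic N dX -> periodic N dY ->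
  (forall i, is_derive (fun s => X s i) t (dX i)) ->
  (forall i, is_derive (fun s => Y s i) t (dY i)) ->
  is_derive (fun s => flux P Q N (X s) (Y s)) t
    (zsum (fun i => flux_grad_x (X t) (Y t) i * dX i + flux_grad_y (X t) (Y t) i * dY i) N).
Proof.
  intros PX PY PdX PdY HX HY.
  set (x := X t) in *. set (y := Y t) in *.
  assert (E : zsum (fun i => flux_grad_x x y i * dX i + flux_grad_y x y i * dY i) N =
    zsum (fun i => ((Px (x i) (y i) * dX i + Py (x i) (y i) * dY i) * ctr y i + P (x i) (y i) * ctr dY i)
      - ((Qx (x i) (y i) * dX i + Qy (x i) (y i) * dY i) * ctr x i + Q (x i) (y i) * ctr dX i)) N).
  { transitivity (zsum (fun i => (Px (x i) (y i) * dX i + Py (x i) (y i) * dY i) * ctr y i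
      - (Qx (x i) (y i) * dX i + Qy (x i) (y i) * dY i) * ctr x i) N
      + (zsum (fun i => P (x i) (y i) * ctr dY i) N - zsum (fun i => Q (x i) (y i) * ctr dX i) N)).
    - rewrite (zsum_ctr_by_parts N (fun i => P (x i) (y i)) dY), (zsum_ctr_by_parts N (fun i => Q (x i) (y i)) dX);
        try assumption; try (apply periodic_comp2; assumption).
      replace (- zsum (fun i => ctr (fun j => P (x j) (y j)) i * dY i) N
         - - zsum (fun i => ctr (fun j => Q (x j) (y j)) i * dX i) N)
        with (zsum (fun i => ctr (fun j => Q (x j) (y j)) i * dX i) N
         - zsum (fun i => ctr (fun j => P (x j) (y j)) i * dY i) N) by ring.
      rewrite <- zsum_minus, <- zsum_plus. apply zsum_ext. intros i.
      unfold flux_grad_x, flux_grad_y. ring.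
    - rewrite <- zsum_minus, <- zsum_plus. apply zsum_ext. intros i. ring. }
  rewrite E.
  apply (is_derive_zsum (fun s i => P (X s i) (Y s i) * ctr (Y s) i - Q (X s i) (Y s i) * ctr (X s) i)).
  intros i. apply is_derive_Rminus.
  - apply (is_derive_Rmult (fun s => P (X s i) (Y s i)) (fun s => ctr (Y s) i)).
    + now apply (is_derive_comp2 P Px Py (fun s => X s i) (fun s => Y s i)).
    + now apply is_derive_ctr.
  - apply (is_derive_Rmult (fun s => Q (X s i) (Y s i)) (fun s => ctr (X s) i)).
    + now apply (is_derive_comp2 Q Qx Qy (fun s => X s i) (fun s => Y s i)).
    + now apply is_derive_ctr.
Qed.

Lemma is_derive_objective (N : nat) (X Y : R -> Z -> R) (dX dY : Z -> R) (t : R) :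
  periodic N (X t) -> periodic N (Y t) -> periodic N dX -> periodic N dY ->
  0 < energy N (X t) (Y t) ->
  (forall i, is_derive (fun s => X s i) t (dX i)) ->
  (forall i, is_derive (fun s => Y s i) t (dY i)) ->
  is_derive (fun s => objective P Q N (X s) (Y s)) t
    (zsum (fun i => objective_grad_x N (X t) (Y t) i * dX i + objective_grad_y N (X t) (Y t) i * dY i) N).
Proof.
  intros PX PY PdX PdY HE HX HY.
  set (l := sqrt (energy N (X t) (Y t))).
  assert (Hl : 0 < l) by (apply sqrt_lt_R0; exact HE).
  assert (E : zsum (fun i => objective_grad_x N (X t) (Y t) i * dX i + objective_grad_y N (X t) (Y t) i * dY i) N
    = (INR N * zsum (fun i => 2 * fwd (X t) i * fwd dX i + 2 * fwd (Y t) i * fwd dY i) N) / (2 * l)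
      - zsum (fun i => flux_grad_x (X t) (Y t) i * dX i + flux_grad_y (X t) (Y t) i * dY i) N).
  { transitivity (INR N / l * (zsum (fun i => fwd (X t) i * fwd dX i) N + zsum (fun i => fwd (Y t) i * fwd dY i) N)
      - zsum (fun i => flux_grad_x (X t) (Y t) i * dX i + flux_grad_y (X t) (Y t) i * dY i) N).
    - rewrite !zsum_fwd_by_parts by assumption.
      rewrite <- zsum_plus, <- zsum_scal, <- zsum_minus. apply zsum_ext. intros i.
      unfold objective_grad_x, objective_grad_y. fold l. ring.
    - f_equal. rewrite <- zsum_plus.
      rewrite (zsum_ext (fun i => 2 * fwd (X t) i * fwd dX i + 2 * fwd (Y t) i * fwd dY i)
        (fun i => 2 * (fwd (X t) i * fwd dX i + fwd (Y t) i * fwd dY i))) by (intros; ring).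
      rewrite zsum_scal. field. lra. }
  rewrite E. apply is_derive_Rminus.
  - apply (is_derive_sqrt (fun s => energy N (X s) (Y s))); [now apply is_derive_energy|exact HE].
  - now apply is_derive_flux.
Qed.

Lemma is_derive_polygon_area (N : nat) (X Y : R -> Z -> R) (dX dY : Z -> R) (t : R) :
  periodic N (X t) -> periodic N (Y t) -> periodic N dX -> periodic N dY ->
  (forall i, is_derive (fun s => X s i) t (dX i)) ->
  (forall i, is_derive (fun s => Y s i) t (dY i)) ->
  is_derive (fun s => polygon_area N (X s) (Y s)) t
    (zsum (fun i => ctr (X t) i * dY i - ctr (Y t) i * dX i) N).
Proof.
  intros PX PY PdX PdY HX HY. set (x := X t) in *. set (y := Y t) in *.
  (* Moving the difference off the variation makes it a backward one; together with the forward one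
     from the product rule it yields [ctr]. *)
  assert (Hparts : forall f g, periodic N f -> periodic N g ->
     zsum (fun i => f i * fwd g i) N = - zsum (fun i => fwd f (i - 1)%Z * g i) N).
  { intros f g Pf Pg.
    transitivity (zsum (fun i => f i * g (i + 1)%Z) N - zsum (fun i => f i * g i) N).
    - rewrite <- zsum_minus. apply zsum_ext. intros. unfold fwd. ring.
    - rewrite (zsum_mul_succ N f g Pf Pg), <- zsum_minus.
      rewrite <- (Rmult_1_l (zsum (fun i => fwd f (i - 1)%Z * g i) N)),
        <- Ropp_mult_distr_l_reverse, <- zsum_scal.
      apply zsum_ext. intros i. unfold fwd. replace (i - 1 + 1)%Z with i by lia. ring. }
  assert (E : zsum (fun i => ctr x i * dY i - ctr y i * dX i) N
    = / 2 * zsum (fun i => (dY i * fwd x i + y i * fwd dX i) - (dX i * fwd y i + x i * fwd dY i)) N).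
  { transitivity (/ 2 * (zsum (fun i => dY i * fwd x i - dX i * fwd y i) N
      + (zsum (fun i => y i * fwd dX i) N - zsum (fun i => x i * fwd dY i) N))).
    - rewrite (Hparts y dX), (Hparts x dY) by assumption.
      replace (- zsum (fun i => fwd y (i - 1)%Z * dX i) N - - zsum (fun i => fwd x (i - 1)%Z * dY i) N)
        with (zsum (fun i => fwd x (i - 1)%Z * dY i) N - zsum (fun i => fwd y (i - 1)%Z * dX i) N) by ring.
      rewrite <- zsum_minus, <- zsum_plus, <- zsum_scal. apply zsum_ext. intros i.
      unfold ctr, fwd. replace (i - 1 + 1)%Z with i by lia. field.
    - f_equal. rewrite <- zsum_minus, <- zsum_plus. apply zsum_ext. intros; ring. }
  rewrite E. apply (is_derive_scal (fun s => zsum _ N)).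
  apply (is_derive_zsum (fun s i => Y s i * fwd (X s) i - X s i * fwd (Y s) i)). intros i.
  apply is_derive_Rminus.
  - apply (is_derive_Rmult (fun s => Y s i) (fun s => fwd (X s) i)); [apply HY|now apply is_derive_fwd].
  - apply (is_derive_Rmult (fun s => X s i) (fun s => fwd (Y s) i)); [apply HX|now apply is_derive_fwd].
Qed.

Lemma polygon_area_scale (N : nat) (s : R) (x y : Z -> R) :
  polygon_area N (fun i => s * x i) (fun i => s * y i) = s * s * polygon_area N x y.
Proof.
  unfold polygon_area.
  rewrite (zsum_ext _ (fun i => s * s * (y i * fwd x i - x i * fwd y i))).
  - rewrite zsum_scal. ring.
  - intros i. unfold fwd. ring.
Qed.

Lemma periodic_objective_grad_x (N : nat) (x y : Z -> R) :
  periodic N x -> periodic N y -> periodic N (objective_grad_x N x y).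
Proof.
  intros Hx Hy i. unfold objective_grad_x, flux_grad_x.
  rewrite (periodic_pred N _ (periodic_fwd N x Hx) i), (periodic_fwd N x Hx i),
    (periodic_ctr N x Hx i), (periodic_ctr N y Hy i), (Hx i), (Hy i),
    (periodic_ctr N _ (periodic_comp2 N Q x y Hx Hy) i). reflexivity.
Qed.

Lemma periodic_objective_grad_y (N : nat) (x y : Z -> R) :
  periodic N x -> periodic N y -> periodic N (objective_grad_y N x y).
Proof.
  intros Hx Hy i. unfold objective_grad_y, flux_grad_y.
  rewrite (periodic_pred N _ (periodic_fwd N y Hy) i), (periodic_fwd N y Hy i),
    (periodic_ctr N x Hx i), (periodic_ctr N y Hy i), (Hx i), (Hy i),
    (periodic_ctr N _ (periodic_comp2 N P x y Hx Hy) i). reflexivity.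
Qed.

(* Perturbations are rescaled to restore the area constraint, which makes the multiplier explicit;
   testing against the residual itself then gives the pointwise equations. *)
Lemma euler_lagrange (N : nat) (a : R) (x y : Z -> R) :
  (0 < N)%nat -> a <> 0 -> periodic N x -> periodic N y -> polygon_area N x y = a ->
  (forall x' y', periodic N x' -> periodic N y' -> polygon_area N x' y' = a ->
      objective P Q N x y <= objective P Q N x' y') ->
  exists lam,
    2 * a * lam = zsum (fun i => objective_grad_x N x y i * x i + objective_grad_y N x y i * y i) N /\
    (forall i, objective_grad_x N x y i = - lam * ctr y i) /\
    (forall i, objective_grad_y N x y i = lam * ctr x i).
Proof.
  intros HN Ha Hx Hy HA Hmin.
  set (gx := objective_grad_x N x y). set (gy := objective_grad_y N x y).
  set (D := zsum (fun i => gx i * x i + gy i * y i) N).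
  (* [D] is the derivative of the objective under dilation, and [2 a] that of the area; their ratio
     is the multiplier. *)
  set (lam := D / (2 * a)).
  assert (HE : 0 < energy N x y) by (now apply (energy_pos_of_area N x y a)).
  assert (Hweak : forall xi eta, periodic N xi -> periodic N eta ->
    zsum (fun i => (gx i + lam * ctr y i) * xi i + (gy i - lam * ctr x i) * eta i) N = 0).
  { intros xi eta Hxi Heta.
    set (dA := zsum (fun i => ctr x i * eta i - ctr y i * xi i) N).
    set (At := fun t => polygon_area N (fun i => x i + t * xi i) (fun i => y i + t * eta i)).
    assert (HAt : is_derive At 0 dA).
    { assert (Hlin : forall f df : Z -> R, forall i, is_derive (fun t => f i + t * df i) 0 (df i)).
      { intros. auto_derive; [exact I|ring]. }
      assert (H0 : forall f df : Z -> R, periodic N f -> periodic N (fun i => f i + 0 * df i)).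
      { intros f df Hf i. rewrite (Hf i). ring. }
      assert (H := is_derive_polygon_area N (fun t i => x i + t * xi i) (fun t i => y i + t * eta i) xi eta 0
        (H0 _ _ Hx) (H0 _ _ Hy) Hxi Heta (Hlin x xi) (Hlin y eta)).
      unfold dA. erewrite zsum_ext; [exact H|]. intros i. unfold ctr. simpl. field. }
    assert (HA0 : At 0 = a).
    { unfold At. rewrite <- HA. unfold polygon_area. f_equal. apply zsum_ext. intros i. unfold fwd. ring. }
    (* The dilation factor that restores the area. For [t] near 0, [At t] keeps the sign of [a] and
       the quotient is positive. *)
    set (s := fun t => sqrt (a / At t)).
    assert (Hs0 : s 0 = 1).
    { unfold s. rewrite HA0. unfold Rdiv. rewrite Rinv_r by exact Ha. apply sqrt_1. }
    set (ds := - dA / (2 * a)).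
    assert (Hs : is_derive s 0 ds).
    { unfold s. assert (Hq : is_derive (fun t => a / At t) 0 (- dA / a)).
      { apply (is_derive_ext (fun t => a * / At t)); [reflexivity|].
        replace (- dA / a) with (a * (- dA / (At 0) ^ 2)) by (rewrite HA0; field; exact Ha).
        apply (is_derive_scal (fun t => / At t)). apply is_derive_inv; [exact HAt|].
        now rewrite HA0. }
      assert (Hpos : 0 < a / At 0) by (rewrite HA0; unfold Rdiv; rewrite Rinv_r by exact Ha; lra).
      assert (H := is_derive_sqrt (fun t => a / At t) 0 _ Hq Hpos).
      cbv beta in H. change (sqrt (a / At 0)) with (s 0) in H. rewrite Hs0 in H. replace ds with (- dA / a / (2 * 1)); [exact H|].
      unfold ds. field. exact Ha. }
    set (X := fun t i => s t * (x i + t * xi i)). set (Y := fun t i => s t * (y i + t * eta i)).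
    assert (HX : forall i, is_derive (fun t => X t i) 0 (xi i + ds * x i)).
    { intros i. replace (xi i + ds * x i) with (ds * (x i + 0 * xi i) + s 0 * xi i) by (rewrite Hs0; ring).
      apply (is_derive_Rmult s (fun t => x i + t * xi i)); [exact Hs|]. auto_derive; [exact I|ring]. }
    assert (HY : forall i, is_derive (fun t => Y t i) 0 (eta i + ds * y i)).
    { intros i. replace (eta i + ds * y i) with (ds * (y i + 0 * eta i) + s 0 * eta i) by (rewrite Hs0; ring).
      apply (is_derive_Rmult s (fun t => y i + t * eta i)); [exact Hs|]. auto_derive; [exact I|ring]. }
    assert (X0 : X 0 = x).
    { apply functional_extensionality. intros i. unfold X. rewrite Hs0. ring. }
    assert (Y0 : Y 0 = y).
    { apply functional_extensionality. intros i. unfold Y. rewrite Hs0. ring. }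
    assert (PX : forall t, periodic N (X t)).
    { intros t i. unfold X. now rewrite (Hx i), (Hxi i). }
    assert (PY : forall t, periodic N (Y t)).
    { intros t i. unfold Y. now rewrite (Hy i), (Heta i). }
    assert (Hobj := is_derive_objective N X Y (fun i => xi i + ds * x i) (fun i => eta i + ds * y i) 0 (PX 0) (PY 0)).
    rewrite X0, Y0 in Hobj. fold gx gy in Hobj.
    specialize (Hobj ltac:(intros i; now rewrite (Hxi i), (Hx i)) ltac:(intros i; now rewrite (Heta i), (Hy i)) HE HX HY).
    apply is_derive_local_min in Hobj.
    - rewrite <- Hobj. symmetry.
      transitivity (zsum (fun i => gx i * xi i + gy i * eta i) N + ds * D).
      + unfold D. rewrite <- zsum_scal, <- zsum_plus. apply zsum_ext. intros; ring.
      + replace (ds * D) with (- lam * dA) by (unfold ds, lam; field; exact Ha).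
        unfold dA. rewrite <- zsum_scal, <- zsum_plus. apply zsum_ext. intros; ring.
    - assert (HAc : continuous (fun t => a * At t) 0).
      { apply continuous_Rmult; [apply continuous_const|]. exact (is_derive_continuous_R _ _ _ HAt). }
      assert (Ha2 : 0 < a * a) by nra.
      generalize (filterlim_Rabs_lt _ _ (a * a) HAc Ha2). apply filter_imp.
      intros t Ht. rewrite HA0 in Ht. apply Rabs_def2 in Ht.
      rewrite X0, Y0. apply Hmin; [apply PX|apply PY|].
      unfold X, Y. rewrite (polygon_area_scale N (s t) (fun i => x i + t * xi i)). fold (At t).
      assert (HAtp : 0 < a * At t) by lra.
      assert (HAt0 : At t <> 0) by (intros h; rewrite h in HAtp; lra).
      unfold s. rewrite sqrt_sqrt; [field; exact HAt0|].
      replace (a / At t) with ((a * At t) / (At t ^ 2)) by (field; exact HAt0).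
      apply Rlt_le, Rdiv_lt_0_compat; [exact HAtp|]. apply pow2_gt_0. exact HAt0. }
  exists lam. split; [unfold lam; field; exact Ha|].
  set (xi := fun i => gx i + lam * ctr y i). set (eta := fun i => gy i - lam * ctr x i).
  assert (Pxi : periodic N xi).
  { intros i. unfold xi. now rewrite (periodic_objective_grad_x N x y Hx Hy i : gx _ = _), (periodic_ctr N y Hy i). }
  assert (Peta : periodic N eta).
  { intros i. unfold eta. now rewrite (periodic_objective_grad_y N x y Hx Hy i : gy _ = _), (periodic_ctr N x Hx i). }
  assert (H0 := Hweak xi eta Pxi Peta).
  assert (Hsq : forall i, xi i * xi i + eta i * eta i = 0).
  { apply (periodic_forall N (fun i => xi i * xi i + eta i * eta i) (fun r => r = 0) HN).
    - intros i. now rewrite (Pxi i), (Peta i).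
    - intros i Hi. assert (Hnn : forall j, 0 <= xi j * xi j + eta j * eta j) by (intros; nra).
      assert (H := zsum_ge_term (fun j => xi j * xi j + eta j * eta j) N i Hnn Hi).
      specialize (Hnn i). simpl in H.
      change (zsum (fun j => xi j * xi j + eta j * eta j) N = 0) in H0. lra. }
  split; intros i; specialize (Hsq i).
  - assert (xi i = 0) by nra. unfold xi in H. lra.
  - assert (eta i = 0) by nra. unfold eta in H. lra.
Qed.

End Variation.

(** * Bounds independent of the number of vertices *)

Ltac Rmult_pos :=
  repeat match goal with |- 0 < _ * _ => apply Rmult_lt_0_compat end; lra.

Lemma Rabs_ctr_le (f : Z -> R) (i : Z) :
  Rabs (ctr f i) <= (Rabs (fwd f i) + Rabs (fwd f (i - 1)%Z)) / 2.
Proof.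
  replace (ctr f i) with ((fwd f i + fwd f (i - 1)%Z) / 2).
  - unfold Rdiv. rewrite Rabs_mult, (Rabs_pos_eq (/ 2)) by lra.
    apply Rmult_le_compat_r; [lra|apply Rabs_triang].
  - unfold ctr, fwd. replace (i - 1 + 1)%Z with i by lia. field.
Qed.

Lemma ctr_variation_le_length (N : nat) (x y : Z -> R) : periodic N x ->
  zsum (fun i => Rabs (ctr x i)) N <= sqrt (energy N x y).
Proof.
  intros Hx. eapply Rle_trans; [|apply variation_le_length].
  set (e := fun i => Rabs (fwd x i)).
  assert (He : periodic N e) by (intros i; unfold e; now rewrite (periodic_fwd N x Hx i)).
  apply Rle_trans with (/ 2 * (zsum e N + zsum (fun i => e (i - 1)%Z) N)).
  - rewrite <- zsum_plus, <- zsum_scal. apply zsum_le. intros i _.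
    assert (H := Rabs_ctr_le x i). unfold e. lra.
  - rewrite (zsum_pred N e He). lra.
Qed.

(** Edges of a polygon of bounded energy are of order [N^(-1/2)]: for large [N] they fit in any
    given radius of strict differentiability. *)
Lemma fwd_sq_le (N : nat) (x y : Z -> R) (i : Z) : (0 < N)%nat -> periodic N x ->
  INR N * fwd x i ^ 2 <= energy N x y.
Proof.
  intros HN Hx. apply Rmult_le_compat_l; [apply pos_INR|].
  apply (periodic_forall N (fwd x) (fun r => r ^ 2 <= _) HN (periodic_fwd N x Hx)).
  intros j Hj. eapply Rle_trans; [|apply (zsum_ge_term (fun i => fwd x i ^ 2 + fwd y i ^ 2) N j)].
  - simpl. assert (H := pow2_ge_0 (fwd y j)). simpl in H. lra.
  - intros k. assert (H1 := pow2_ge_0 (fwd x k)). assert (H2 := pow2_ge_0 (fwd y k)). lra.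
  - exact Hj.
Qed.

(** A discrete chain rule, linearised at the middle vertex; its error is relative to the central
    differences, hence summable along the polygon. *)
Lemma strict_diff_ctr (f fx fy : R -> R -> R) (eta d : R) (x y : Z -> R) (i : Z) :
  (forall x y x1 y1 x2 y2,
     Rabs (x1 - x) <= d -> Rabs (y1 - y) <= d -> Rabs (x2 - x) <= d -> Rabs (y2 - y) <= d ->
     Rabs (f x2 y2 - f x1 y1 - (fx x y * (x2 - x1) + fy x y * (y2 - y1)))
      <= eta * (Rabs (x2 - x1) + Rabs (y2 - y1))) ->
  (forall i, Rabs (fwd x i) <= d) -> (forall i, Rabs (fwd y i) <= d) ->
  Rabs (ctr (fun j => f (x j) (y j)) i - (fx (x i) (y i) * ctr x i + fy (x i) (y i) * ctr y i))
    <= eta * (Rabs (ctr x i) + Rabs (ctr y i)).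
Proof.
  intros Hf Hx Hy.
  assert (Hm : forall z : Z -> R, (forall i, Rabs (fwd z i) <= d) -> Rabs (z (i - 1)%Z - z i) <= d).
  { intros z Hz. specialize (Hz (i - 1)%Z). unfold fwd in Hz.
    replace (i - 1 + 1)%Z with i in Hz by lia. now rewrite Rabs_minus_sym. }
  assert (H := Hf (x i) (y i) _ _ _ _ (Hm x Hx) (Hm y Hy) (Hx i) (Hy i)).
  assert (H2 : forall z : Z -> R, z (i + 1)%Z - z (i - 1)%Z = 2 * ctr z i) by (intros; unfold ctr; field).
  rewrite !H2, !Rabs_mult, (Rabs_pos_eq 2) in H by lra.
  replace (f (x (i + 1)%Z) (y (i + 1)%Z) - f (x (i - 1)%Z) (y (i - 1)%Z))
    with (2 * ctr (fun j => f (x j) (y j)) i) in H by (unfold ctr; field).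
  match type of H with Rabs ?u <= _ => replace u with
    (2 * (ctr (fun j => f (x j) (y j)) i - (fx (x i) (y i) * ctr x i + fy (x i) (y i) * ctr y i))) in H by ring end.
  rewrite Rabs_mult, (Rabs_pos_eq 2) in H by lra. lra.
Qed.

(* The constants [B] and [l0] do not depend on the tolerance [delta]. *)
Lemma discrete_solution_exists (g : R -> R -> R) (c a : R) :
  unif2 g -> (forall x y, g (x + 1) y = g x y) -> (forall x y, g x (y + 1) = g x y) ->
  (forall x y, Rabs (g x y) <= c) -> RInt (fun x => RInt (g x) 0 1) 0 1 = 0 ->
  0 < c < 2 * sqrt 2 -> a <> 0 ->
  exists B l0, 0 < l0 /\ forall delta K, 0 < delta ->
    exists (N : nat) (x y : Z -> R) (lam l : R),
      K <= INR N /\ 0 < INR N /\ periodic N x /\ periodic N y /\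
      l0 <= l <= B /\ Rabs lam <= B /\
      (forall i, Rabs (x i) <= B /\ Rabs (y i) <= B) /\
      (forall i, Rabs (INR N * fwd x i) <= B /\ Rabs (INR N * fwd y i) <= B) /\
      (forall i, Rabs (INR N * fwd (fun j => INR N * fwd x j) i) <= B /\
                 Rabs (INR N * fwd (fun j => INR N * fwd y j) i) <= B) /\
      (forall i, Rabs (INR N * fwd (fun j => INR N * fwd x j) i
          + l * (g (x (i + 1)%Z) (y (i + 1)%Z) - lam)
            * ((INR N * fwd y i + INR N * fwd y (i + 1)%Z) / 2)) <= delta) /\
      (forall i, Rabs (INR N * fwd (fun j => INR N * fwd y j) i
          - l * (g (x (i + 1)%Z) (y (i + 1)%Z) - lam)
            * ((INR N * fwd x i + INR N * fwd x (i + 1)%Z) / 2)) <= delta) /\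
      energy N x y = l * l /\ polygon_area N x y = a.
Proof.
  intros Ug gx gy gc gmean [Hc0 Hc] Ha.
  assert (Hs2 : sqrt 2 * sqrt 2 = 2) by (apply sqrt_sqrt; lra).
  assert (Hs2p : 0 < sqrt 2) by (apply sqrt_lt_R0; lra).
  set (k := sqrt 2 * (c / 4)).
  assert (Hk : 0 < k < 1).
  { split; [apply Rmult_lt_0_compat; lra|]. unfold k.
    assert (sqrt 2 * c < sqrt 2 * (2 * sqrt 2)) by (apply Rmult_lt_compat_l; lra). lra. }
  assert (Hbk : 2 * (c / 4) ^ 2 <= k ^ 2).
  { unfold k. replace ((sqrt 2 * (c / 4)) ^ 2) with ((sqrt 2 * sqrt 2) * (c / 4) ^ 2) by ring. rewrite Hs2. lra. }
  assert (Haa : 0 < Rabs a) by (apply Rabs_pos_lt; exact Ha).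
  (* Bounds [l]: [(1 - k) l] is at most the minimum, which is at most the objective of the regular
     polygon. *)
  set (L := (1 + k) / (1 - k) * sqrt (8 * PI * Rabs a)).
  assert (HL : 0 < L).
  { apply Rmult_lt_0_compat; [apply Rdiv_lt_0_compat; lra|]. apply sqrt_lt_R0.
    apply Rmult_lt_0_compat; [|exact Haa]. assert (H := PI_RGT_0). lra. }
  (* Bounds the multiplier through [2 a lam = l - sum V . x], with [|x| <= 1 + L],
     [|V| <= (c + 1) w] per component and [sum w <= 2 L]. *)
  set (Lam := (L + 4 * (c + 1) * (1 + L) * L) / (2 * Rabs a)).
  assert (HLam : 0 < Lam).
  { apply Rdiv_lt_0_compat; [|lra]. apply Rplus_lt_0_compat; [exact HL|].
    Rmult_pos. }
  (* Bounds the total variation of each velocity component. *)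
  set (T := L * (Lam + c + 1) * (2 * L)).
  assert (HT : 0 < T) by (unfold T; Rmult_pos).
  (* Bounds the second-order quotients: their size is governed by [N w], which is at most [4 T]. *)
  set (T2 := L * (Lam + c + 1) * (4 * T)).
  assert (HT2 : 0 < T2) by (unfold T2; Rmult_pos).
  exists (1 + L + Lam + 2 * T + T2), (sqrt (Rabs a)).
  split; [apply sqrt_lt_R0; exact Haa|].
  intros delta K Hdelta.
  assert (HLT : 0 < 4 * L * T + 1).
  { assert (0 < L * T) by (apply Rmult_lt_0_compat; lra). lra. }
  (* The error in the equation is at most [4 L T e]; [e <= 1] keeps the constants above free of
     [delta]. *)
  set (e := Rmin 1 (delta / (4 * L * T + 1))).
  assert (He : 0 < e) by (apply Rmin_glb_lt; [lra|apply Rdiv_lt_0_compat; lra]).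
  assert (He1 : e <= 1) by apply Rmin_l.
  assert (Hed : L * e * (4 * T) <= delta).
  { apply Rle_trans with (e * (4 * L * T + 1)); [nra|].
    apply Rle_trans with (delta / (4 * L * T + 1) * (4 * L * T + 1)); [|right; field; lra].
    apply Rmult_le_compat_r; [lra|apply Rmin_r]. }
  destruct (potential_exists g c (e / 2) Ug gx gy gc gmean ltac:(lra))
    as [P [Px [Py [Q [Qx [Qy [SP [SQ [Hdiv [Pb [Qb [Pper Qper]]]]]]]]]]]].
  destruct (SP (e / 2) ltac:(lra)) as [d1 [Hd1 S1]].
  destruct (SQ (e / 2) ltac:(lra)) as [d2 [Hd2 S2]].
  set (d := Rmin d1 d2).
  assert (Hd : 0 < d) by (apply Rmin_glb_lt; lra).
  assert (Hdd1 : d <= d1) by apply Rmin_l. assert (Hdd2 : d <= d2) by apply Rmin_r.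
  (* [N > L^2 / d^2] makes every coordinate increment at most [d]; the 3 is for the regular
     polygon. *)
  assert (HN : exists N : nat, Rabs K + 3 + L ^ 2 / d ^ 2 < INR N).
  { destruct (nfloor_ex (Rabs K + 3 + L ^ 2 / d ^ 2)) as [n Hn].
    - assert (H := Rabs_pos K). assert (0 < L ^ 2 / d ^ 2) by (apply Rdiv_lt_0_compat; apply pow_lt; lra). lra.
    - exists (S n). rewrite S_INR. lra. }
  destruct HN as [N HN].
  assert (HLd : 0 < L ^ 2 / d ^ 2) by (apply Rdiv_lt_0_compat; apply pow_lt; lra).
  assert (HK := Rle_abs K). assert (HK0 := Rabs_pos K).
  assert (HN3 : (3 <= N)%nat) by (apply INR_le; simpl; lra).
  assert (HN0 : (0 < N)%nat) by lia.
  assert (HNR : 0 < INR N) by lra.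
  destruct (regular_polygon_exists N a HN3 Ha) as [xr [yr [Pxr [Pyr [HAr HEr]]]]].
  destruct (minimiser_exists P Q (c / 4) k Pb Qb (proj1 Hk) Hbk Pper Qper
     (strict_diff_continuous_seq2 _ _ _ SP) (strict_diff_continuous_seq2 _ _ _ SQ) (proj2 Hk)
     N a xr yr HN0 Ha Pxr Pyr HAr)
    as [x [y [Hx [Hy [HA [Hx0 [Hy0 Hmin]]]]]]].
  assert (HE := energy_pos_of_area N x y a Ha Hx Hy HA).
  set (l := sqrt (energy N x y)).
  assert (Hl : 0 < l) by (apply sqrt_lt_R0; exact HE).
  assert (Hll : energy N x y = l * l) by (symmetry; apply sqrt_sqrt; lra).
  assert (HlL : l <= L).
  { assert (H1 := objective_lower P Q (c / 4) k Pb Qb (proj1 Hk) Hbk N x y HN0 Hx Hy HE).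
    assert (H2 := Hmin xr yr Pxr Pyr HAr).
    assert (HEr0 := energy_pos_of_area N xr yr a Ha Pxr Pyr HAr).
    assert (H3 := objective_upper P Q (c / 4) k Pb Qb (proj1 Hk) Hbk N xr yr HN0 Pxr Pyr HEr0).
    apply sqrt_le_1_alt in HEr.
    apply (Rmult_le_compat_l (1 + k)) in HEr; [|lra].
    fold l in H1. apply (Rmult_le_reg_l (1 - k)); [lra|].
    replace ((1 - k) * L) with ((1 + k) * sqrt (8 * PI * Rabs a)) by (unfold L; field; lra). lra. }
  assert (Hl0 : sqrt (Rabs a) <= l).
  { apply sqrt_le_1_alt. rewrite <- HA. now apply polygon_area_le_energy. }
  assert (Hxb : forall i, Rabs (x i) <= 1 + L).
  { apply (periodic_forall N x (fun r => Rabs r <= 1 + L) HN0 Hx). intros i Hi.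
    assert (H := distance_le_length N x y i Hi). fold l in H.
    replace (x i) with (x 0%Z + (x i - x 0%Z)) by ring.
    eapply Rle_trans; [apply Rabs_triang|]. lra. }
  assert (Hyb : forall i, Rabs (y i) <= 1 + L).
  { apply (periodic_forall N y (fun r => Rabs r <= 1 + L) HN0 Hy). intros i Hi.
    assert (H := distance_le_length N y x i Hi). rewrite energy_sym in H. fold l in H.
    replace (y i) with (y 0%Z + (y i - y 0%Z)) by ring.
    eapply Rle_trans; [apply Rabs_triang|]. lra. }
  assert (Hsmall : forall z, INR N * z ^ 2 <= energy N x y -> Rabs z <= d).
  { intros z Hz. rewrite <- (Rabs_pos_eq d) by lra. apply Rsqr_le_abs_0. rewrite !Rsqr_pow2.
    apply (Rmult_le_reg_l (INR N)); [exact HNR|].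
    apply Rle_trans with (L ^ 2); [rewrite Hll in Hz; nra|].
    apply Rle_trans with (L ^ 2 / d ^ 2 * d ^ 2); [right; field; lra|].
    apply Rmult_le_compat_r; [apply pow2_ge_0|lra]. }
  assert (Hfx : forall i, Rabs (fwd x i) <= d) by (intros i; apply Hsmall; now apply fwd_sq_le).
  assert (Hfy : forall i, Rabs (fwd y i) <= d).
  { intros i. apply Hsmall. rewrite energy_sym. now apply fwd_sq_le. }
  set (w := fun i => Rabs (ctr x i) + Rabs (ctr y i)).
  assert (Hw0 : forall i, 0 <= w i).
  { intros i. unfold w. assert (H1 := Rabs_pos (ctr x i)). assert (H2 := Rabs_pos (ctr y i)). lra. }
  assert (HW : zsum w N <= 2 * L).
  { unfold w. rewrite zsum_plus.
    assert (H1 := ctr_variation_le_length N x y Hx). assert (H2 := ctr_variation_le_length N y x Hy).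
    rewrite energy_sym in H2. fold l in H1, H2. lra. }
  set (Vx := flux_grad_x Px Q Qx x y). set (Vy := flux_grad_y P Py Qy x y).
  (* Half of [e] pays for the chain rule, half for the error in the divergence. *)
  assert (HVx : forall i, Rabs (Vx i - g (x i) (y i) * ctr y i) <= e * w i).
  { intros i. assert (H := strict_diff_ctr Q Qx Qy (e / 2) d x y i
      ltac:(intros; apply S2; lra) Hfx Hfy).
    assert (H1 := Hdiv (x i) (y i)).
    unfold Vx, flux_grad_x.
    match goal with |- Rabs ?u <= _ => replace u with
      ((ctr (fun j => Q (x j) (y j)) i - (Qx (x i) (y i) * ctr x i + Qy (x i) (y i) * ctr y i))
       + (Px (x i) (y i) + Qy (x i) (y i) - g (x i) (y i)) * ctr y i) by ring end.
    eapply Rle_trans; [apply Rabs_triang|]. rewrite Rabs_mult.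
    assert (H2 := Rabs_pos (ctr x i)). assert (H3 := Rabs_pos (ctr y i)). unfold w. nra. }
  assert (HVy : forall i, Rabs (Vy i + g (x i) (y i) * ctr x i) <= e * w i).
  { intros i. assert (H := strict_diff_ctr P Px Py (e / 2) d x y i
      ltac:(intros; apply S1; lra) Hfx Hfy).
    assert (H1 := Hdiv (x i) (y i)).
    unfold Vy, flux_grad_y.
    match goal with |- Rabs ?u <= _ => replace u with
      (- ((ctr (fun j => P (x j) (y j)) i - (Px (x i) (y i) * ctr x i + Py (x i) (y i) * ctr y i))
       + (Px (x i) (y i) + Qy (x i) (y i) - g (x i) (y i)) * ctr x i)) by ring end.
    rewrite Rabs_Ropp. eapply Rle_trans; [apply Rabs_triang|]. rewrite Rabs_mult.
    assert (H2 := Rabs_pos (ctr x i)). assert (H3 := Rabs_pos (ctr y i)). unfold w. nra. }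
  assert (Hgw : forall i z, Rabs z <= w i -> Rabs (g (x i) (y i) * z) <= c * w i).
  { intros i z Hz. rewrite Rabs_mult. apply Rmult_le_compat; auto using Rabs_pos. }
  assert (Hcw : forall i, Rabs (ctr x i) <= w i /\ Rabs (ctr y i) <= w i).
  { intros i. unfold w. assert (H2 := Rabs_pos (ctr x i)). assert (H3 := Rabs_pos (ctr y i)). lra. }
  assert (HVxb : forall i, Rabs (Vx i) <= (c + 1) * w i).
  { intros i. replace (Vx i) with ((Vx i - g (x i) (y i) * ctr y i) + g (x i) (y i) * ctr y i) by ring.
    eapply Rle_trans; [apply Rabs_triang|]. specialize (HVx i). specialize (Hw0 i).
    assert (H := Hgw i _ (proj2 (Hcw i))). nra. }
  assert (HVyb : forall i, Rabs (Vy i) <= (c + 1) * w i).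
  { intros i. replace (Vy i) with ((Vy i + g (x i) (y i) * ctr x i) - g (x i) (y i) * ctr x i) by ring.
    eapply Rle_trans; [apply Rabs_triang|]. rewrite Rabs_Ropp. specialize (HVy i). specialize (Hw0 i).
    assert (H := Hgw i _ (proj1 (Hcw i))). nra. }
  destruct (euler_lagrange P Px Py Q Qx Qy SP SQ N a x y HN0 Ha Hx Hy HA Hmin) as [lam [Elam [ELx ELy]]].
  assert (Hlam : Rabs lam <= Lam).
  { assert (E1 : 2 * a * lam = l - zsum (fun i => Vx i * x i + Vy i * y i) N).
    { rewrite Elam.
      transitivity (INR N / l * (zsum (fun i => fwd x i * fwd x i) N + zsum (fun i => fwd y i * fwd y i) N)
        - zsum (fun i => Vx i * x i + Vy i * y i) N).
      - rewrite !zsum_fwd_by_parts by assumption.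
        rewrite <- zsum_plus, <- zsum_scal, <- zsum_minus. apply zsum_ext. intros i.
        unfold objective_grad_x, objective_grad_y. fold l Vx Vy. ring.
      - f_equal. rewrite <- zsum_plus.
        transitivity (energy N x y / l); [|rewrite Hll; field; lra].
        unfold energy. rewrite (zsum_ext (fun i => fwd x i ^ 2 + fwd y i ^ 2)
          (fun i => fwd x i * fwd x i + fwd y i * fwd y i)) by (intros; ring). field. lra. }
    assert (H : Rabs (zsum (fun i => Vx i * x i + Vy i * y i) N) <= 4 * (c + 1) * (1 + L) * L).
    { eapply Rle_trans; [apply zsum_abs|].
      apply Rle_trans with (zsum (fun i => (2 * (c + 1) * (1 + L)) * w i) N).
      - apply zsum_le. intros i _. eapply Rle_trans; [apply Rabs_triang|]. rewrite !Rabs_mult.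
        assert (A1 : Rabs (Vx i) * Rabs (x i) <= ((c + 1) * w i) * (1 + L))
          by (apply Rmult_le_compat; auto using Rabs_pos).
        assert (A2 : Rabs (Vy i) * Rabs (y i) <= ((c + 1) * w i) * (1 + L))
          by (apply Rmult_le_compat; auto using Rabs_pos). lra.
      - rewrite zsum_scal.
        apply Rle_trans with (2 * (c + 1) * (1 + L) * (2 * L)); [|right; ring].
        apply Rmult_le_compat_l; [|exact HW]. apply Rlt_le. Rmult_pos. }
    apply (Rmult_le_reg_l (2 * Rabs a)); [lra|].
    replace (2 * Rabs a * Lam) with (L + 4 * (c + 1) * (1 + L) * L) by (unfold Lam; field; lra).
    replace (2 * Rabs a * Rabs lam) with (Rabs (2 * a * lam))
      by (rewrite !Rabs_mult, (Rabs_pos_eq 2) by lra; ring).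
    rewrite E1. eapply Rle_trans; [apply Rabs_triang|]. rewrite Rabs_Ropp, (Rabs_pos_eq l) by lra. lra. }
  set (p := fun j => INR N * fwd x j). set (r := fun j => INR N * fwd y j).
  assert (Ex : forall i, p i - p (i - 1)%Z = l * (lam * ctr y i - Vx i)).
  { intros i. assert (H := ELx i). unfold objective_grad_x in H. fold l Vx in H.
    assert (H1 : INR N / l * (fwd x (i - 1)%Z - fwd x i) = Vx i - lam * ctr y i) by lra.
    unfold p. replace (INR N * fwd x i - INR N * fwd x (i - 1)%Z)
      with (- l * (INR N / l * (fwd x (i - 1)%Z - fwd x i))) by (field; lra).
    rewrite H1. ring. }
  assert (Ey : forall i, r i - r (i - 1)%Z = l * (- lam * ctr x i - Vy i)).
  { intros i. assert (H := ELy i). unfold objective_grad_y in H. fold l Vy in H.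
    assert (H1 : INR N / l * (fwd y (i - 1)%Z - fwd y i) = Vy i + lam * ctr x i) by lra.
    unfold r. replace (INR N * fwd y i - INR N * fwd y (i - 1)%Z)
      with (- l * (INR N / l * (fwd y (i - 1)%Z - fwd y i))) by (field; lra).
    rewrite H1. ring. }
  assert (Hstep : forall z v i, Rabs z <= w i -> Rabs v <= (c + 1) * w i ->
     Rabs (l * (lam * z - v)) <= L * (Lam + c + 1) * w i).
  { intros z v i Hz Hv. rewrite Rabs_mult, (Rabs_pos_eq l), Rmult_assoc by lra.
    apply Rmult_le_compat; [lra|apply Rabs_pos|exact HlL|].
    eapply Rle_trans; [apply Rabs_triang|]. rewrite Rabs_Ropp, Rabs_mult.
    assert (H : Rabs lam * Rabs z <= Lam * w i) by (apply Rmult_le_compat; auto using Rabs_pos). lra. }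
  assert (Dx : forall i, Rabs (p i - p (i - 1)%Z) <= L * (Lam + c + 1) * w i).
  { intros i. rewrite Ex. apply Hstep; [apply Hcw|apply HVxb]. }
  assert (Dy : forall i, Rabs (r i - r (i - 1)%Z) <= L * (Lam + c + 1) * w i).
  { intros i. rewrite Ey. replace (- lam * ctr x i) with (lam * - ctr x i) by ring.
    apply Hstep; [rewrite Rabs_Ropp; apply Hcw|apply HVyb]. }
  (* An energy bound alone leaves single velocities of order [sqrt N]. The equations bound their
     variation by the sum of [w], and their mean vanishes. *)
  assert (Hbound : forall (z q : Z -> R), periodic N z -> (forall j, q j = INR N * fwd z j) ->
    (forall i, Rabs (q i - q (i - 1)%Z) <= L * (Lam + c + 1) * w i) -> forall i, Rabs (q i) <= 2 * T).
  { intros z q Hz Hq Dq i.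
    assert (Pq : periodic N q) by (intros j; rewrite !Hq; now rewrite (periodic_fwd N z Hz j)).
    eapply Rle_trans; [apply (periodic_mean_zero_bound N q i HN0 Pq)|].
    - rewrite (zsum_ext q (fun j => INR N * fwd z j)) by exact Hq.
      rewrite zsum_scal, zsum_fwd, <- (Z.add_0_l (Z.of_nat N)), (Hz 0%Z). ring.
    - apply Rmult_le_compat_l; [lra|].
      rewrite <- (zsum_pred N (fun j => Rabs (fwd q j)))
        by (intros j; now rewrite (periodic_fwd N q Pq j)).
      apply Rle_trans with (zsum (fun i => L * (Lam + c + 1) * w i) N).
      + apply zsum_le. intros j _. unfold fwd. replace (j - 1 + 1)%Z with j by lia. apply Dq.
      + rewrite zsum_scal. apply Rmult_le_compat_l; [|exact HW].
        apply Rlt_le. Rmult_pos. }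
  assert (Hp : forall i, Rabs (p i) <= 2 * T) by (apply (Hbound x p Hx); [reflexivity|exact Dx]).
  assert (Hr : forall i, Rabs (r i) <= 2 * T) by (apply (Hbound y r Hy); [reflexivity|exact Dy]).
  assert (Hcp : forall i, INR N * ctr x i = (p (i - 1)%Z + p i) / 2).
  { intros i. unfold p, ctr, fwd. replace (i - 1 + 1)%Z with i by lia. field. }
  assert (Hcr : forall i, INR N * ctr y i = (r (i - 1)%Z + r i) / 2).
  { intros i. unfold r, ctr, fwd. replace (i - 1 + 1)%Z with i by lia. field. }
  (* Bootstrap: rescaled central differences are averages of neighbouring velocities, so the summed
     bound on [w] becomes pointwise. *)
  assert (HNw : forall i, INR N * w i <= 4 * T).
  { intros i. unfold w. rewrite Rmult_plus_distr_l.
    rewrite <- (Rabs_pos_eq (INR N)) by lra. rewrite <- !Rabs_mult, Hcp, Hcr.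
    assert (A1 : Rabs ((p (i - 1)%Z + p i) / 2) <= 2 * T).
    { assert (H1 := Hp i). assert (H2 := Hp (i - 1)%Z).
      apply Rabs_le_between in H1. apply Rabs_le_between in H2. apply Rabs_le. lra. }
    assert (A2 : Rabs ((r (i - 1)%Z + r i) / 2) <= 2 * T).
    { assert (H1 := Hr i). assert (H2 := Hr (i - 1)%Z).
      apply Rabs_le_between in H1. apply Rabs_le_between in H2. apply Rabs_le. lra. }
    lra. }
  assert (HNabs : forall z, Rabs (INR N * z) = INR N * Rabs z).
  { intros z. rewrite Rabs_mult, (Rabs_pos_eq (INR N)) by lra. reflexivity. }
  assert (Hsecond : forall (q : Z -> R), (forall i, Rabs (q i - q (i - 1)%Z) <= L * (Lam + c + 1) * w i) ->
    forall i, Rabs (INR N * fwd q i) <= T2).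
  { intros q Dq i. specialize (Dq (i + 1)%Z). replace (i + 1 - 1)%Z with i in Dq by lia.
    rewrite HNabs. unfold fwd.
    apply Rle_trans with (L * (Lam + c + 1) * (INR N * w (i + 1)%Z)); [nra|].
    apply Rmult_le_compat_l; [|apply HNw]. apply Rlt_le. Rmult_pos. }
  exists N, x, y, lam, l.
  split; [lra|]. split; [exact HNR|]. split; [exact Hx|]. split; [exact Hy|].
  split; [lra|]. split; [lra|].
  split; [intros i; specialize (Hxb i); specialize (Hyb i); lra|].
  split; [intros i; specialize (Hp i); specialize (Hr i); unfold p, r in *; lra|].
  split; [intros i; assert (H1 := Hsecond p Dx i); assert (H2 := Hsecond r Dy i); fold p r; lra|].
  assert (Herr : forall i u, Rabs u <= e * w i -> Rabs (INR N * (l * u)) <= delta).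
  { intros i u Hu. rewrite HNabs, Rabs_mult, (Rabs_pos_eq l) by lra.
    apply Rle_trans with (L * e * (4 * T)); [|exact Hed].
    apply Rle_trans with (L * e * (INR N * w i)).
    - replace (L * e * (INR N * w i)) with (INR N * (L * (e * w i))) by ring.
      apply Rmult_le_compat_l; [lra|]. apply Rmult_le_compat; auto using Rabs_pos; lra.
    - apply Rmult_le_compat_l; [|apply HNw]. apply Rmult_le_pos; lra. }
  split; [|split; [|split; [exact Hll|exact HA]]].
  (* The Euler-Lagrange equation at vertex [i + 1], where the central difference averages the
     velocities of index [i] and [i + 1]. *)
  - intros i. fold p r. fold (r i) (r (i + 1)%Z).
    assert (H := Herr (i + 1)%Z _ (HVx (i + 1)%Z)). rewrite <- Rabs_Ropp in H.
    assert (E1 := Ex (i + 1)%Z). assert (E2 := Hcr (i + 1)%Z).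
    replace (i + 1 - 1)%Z with i in E1, E2 by lia.
    rewrite <- E2. unfold fwd. rewrite E1.
    match goal with |- Rabs ?u <= _ => match type of H with Rabs ?v <= _ => replace u with v by ring end end.
    exact H.
  - intros i. fold p r. fold (p i) (p (i + 1)%Z).
    assert (H := Herr (i + 1)%Z _ (HVy (i + 1)%Z)). rewrite <- Rabs_Ropp in H.
    assert (E1 := Ey (i + 1)%Z). assert (E2 := Hcp (i + 1)%Z).
    replace (i + 1 - 1)%Z with i in E1, E2 by lia.
    rewrite <- E2. unfold fwd. rewrite E1.
    match goal with |- Rabs ?u <= _ => match type of H with Rabs ?v <= _ => replace u with v by ring end end.
    exact H.
Qed.

(** * Passage to the limit *)

Lemma filterlim_unif2 {T : Type} {F : (T -> Prop) -> Prop} {FF : Filter F}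
  (g : R -> R -> R) (u v : T -> R) (x y : R) :
  unif2 g -> filterlim u F (locally x) -> filterlim v F (locally y) ->
  filterlim (fun n => g (u n) (v n)) F (locally (g x y)).
Proof.
  intros Ug Hu Hv. apply filterlim_Rabs_le. intros eps Heps.
  destruct (Ug eps Heps) as [d [Hd H]].
  generalize (filter_and _ _ (filterlim_Rabs_lt u x d Hu Hd) (filterlim_Rabs_lt v y d Hv Hd)).
  apply filter_imp. intros n [H1 H2]. apply H; lra.
Qed.

Lemma node_0 (N : nat -> nat) (n : nat) : node N 0 n = 0%Z.
Proof. unfold node. symmetry. apply Int_part_spec. lra. Qed.

Lemma node_succ (N : nat -> nat) (t : R) (n : nat) :
  node N (t + 1) n = (node N t n + Z.of_nat (N n))%Z.
Proof.
  unfold node. symmetry. apply Int_part_spec.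
  destruct (base_Int_part (t * INR (N n))). rewrite plus_IZR, <- INR_IZR_INZ. lra.
Qed.

(** The period is normalised to 1, so the constant speed [l] is the length of the loop. *)
Lemma magnetic_loop_exists (g : R -> R -> R) (c a : R) :
  unif2 g -> (forall x y, g (x + 1) y = g x y) -> (forall x y, g x (y + 1) = g x y) ->
  (forall x y, Rabs (g x y) <= c) -> RInt (fun x => RInt (g x) 0 1) 0 1 = 0 ->
  0 < c < 2 * sqrt 2 -> a <> 0 ->
  exists (X Y VX VY : R -> R) (lam l : R),
    0 < l /\
    (forall t, X (t + 1) = X t) /\ (forall t, Y (t + 1) = Y t) /\
    (forall t, is_derive X t (VX t)) /\ (forall t, is_derive Y t (VY t)) /\
    (forall t, is_derive VX t (- (l * (g (X t) (Y t) - lam) * VY t))) /\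
    (forall t, is_derive VY t (l * (g (X t) (Y t) - lam) * VX t)) /\
    (forall t, VX t * VX t + VY t * VY t = l * l) /\
    is_RInt (fun t => / 2 * (Y t * VX t - X t * VY t)) 0 1 a.
Proof.
  intros Ug gx gy gc gmean Hc Ha.
  destruct (discrete_solution_exists g c a Ug gx gy gc gmean Hc Ha) as [B [l0 [Hl0 Hdisc]]].
  (* Stage [n] has tolerance [1 / (n + 1)] and at least [n] vertices, while [B] and [l0] stay
     fixed. *)
  destruct (choice (fun (n : nat) (s : nat * ((Z -> R) * (Z -> R)) * (R * R)) =>
    let N := fst (fst s) in let x := fst (snd (fst s)) in let y := snd (snd (fst s)) in
    let lam := fst (snd s) in let l := snd (snd s) in
      INR n <= INR N /\ 0 < INR N /\ periodic N x /\ periodic N y /\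
      l0 <= l <= B /\ Rabs lam <= B /\
      (forall i, Rabs (x i) <= B /\ Rabs (y i) <= B) /\
      (forall i, Rabs (INR N * fwd x i) <= B /\ Rabs (INR N * fwd y i) <= B) /\
      (forall i, Rabs (INR N * fwd (fun j => INR N * fwd x j) i) <= B /\
                 Rabs (INR N * fwd (fun j => INR N * fwd y j) i) <= B) /\
      (forall i, Rabs (INR N * fwd (fun j => INR N * fwd x j) i
          + l * (g (x (i + 1)%Z) (y (i + 1)%Z) - lam)
            * ((INR N * fwd y i + INR N * fwd y (i + 1)%Z) / 2)) <= / (INR n + 1)) /\
      (forall i, Rabs (INR N * fwd (fun j => INR N * fwd y j) i
          - l * (g (x (i + 1)%Z) (y (i + 1)%Z) - lam)
            * ((INR N * fwd x i + INR N * fwd x (i + 1)%Z) / 2)) <= / (INR n + 1)) /\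
      energy N x y = l * l /\ polygon_area N x y = a)) as [s Hs].
  { intros n.
    destruct (Hdisc (/ (INR n + 1)) (INR n)) as [N [x [y [lam [l H]]]]].
    { apply Rinv_0_lt_compat. assert (H := pos_INR n). lra. }
    exists (N, (x, y), (lam, l)). exact H. }
  destruct (choice (fun (n : nat) (S : Z -> R) => S 0%Z = 0 /\
    (forall i, fwd S i = / 2 * (snd (snd (fst (s n))) i * fwd (fst (snd (fst (s n)))) i
      - fst (snd (fst (s n))) i * fwd (snd (snd (fst (s n)))) i)) /\
    forall m, S (Z.of_nat m) = zsum (fun i => / 2 * (snd (snd (fst (s n))) i * fwd (fst (snd (fst (s n)))) i
      - fst (snd (fst (s n))) i * fwd (snd (snd (fst (s n)))) i)) m)) as [area_sum Harea].
  { intros n. apply zsum_antidifference. }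
  destruct (choice (fun (n : nat) (S : Z -> R) => S 0%Z = 0 /\
    (forall i, fwd S i = INR (fst (fst (s n))) * (fwd (fst (snd (fst (s n)))) i ^ 2
      + fwd (snd (snd (fst (s n)))) i ^ 2)) /\
    forall m, S (Z.of_nat m) = zsum (fun i => INR (fst (fst (s n))) * (fwd (fst (snd (fst (s n)))) i ^ 2
      + fwd (snd (snd (fst (s n)))) i ^ 2)) m)) as [energy_sum Henergy].
  { intros n. apply zsum_antidifference. }
  set (N := fun n => fst (fst (s n))).
  set (x := fun n => fst (snd (fst (s n)))). set (y := fun n => snd (snd (fst (s n)))).
  set (lam := fun n => fst (snd (s n))). set (l := fun n => snd (snd (s n))).
  set (p := fun n i => INR (N n) * fwd (x n) i). set (r := fun n i => INR (N n) * fwd (y n) i).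
  assert (HN0 : forall n, 0 < INR (N n)) by apply Hs.
  assert (Hl : forall n, l0 <= l n <= B) by apply Hs.
  assert (Hlam : forall n, Rabs (lam n) <= B) by apply Hs.
  assert (Hxy : forall n i, Rabs (x n i) <= B /\ Rabs (y n i) <= B) by apply Hs.
  assert (Hpr : forall n i, Rabs (p n i) <= B /\ Rabs (r n i) <= B) by apply Hs.
  assert (Hdpr : forall n i, Rabs (INR (N n) * fwd (p n) i) <= B /\ Rabs (INR (N n) * fwd (r n) i) <= B) by apply Hs.
  assert (Hep : forall n i, Rabs (INR (N n) * fwd (p n) i
     + l n * (g (x n (i + 1)%Z) (y n (i + 1)%Z) - lam n) * ((r n i + r n (i + 1)%Z) / 2)) <= / (INR n + 1)) by apply Hs.
  assert (Her : forall n i, Rabs (INR (N n) * fwd (r n) i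
     - l n * (g (x n (i + 1)%Z) (y n (i + 1)%Z) - lam n) * ((p n i + p n (i + 1)%Z) / 2)) <= / (INR n + 1)) by apply Hs.
  destruct ultrafilter_nat_exists as [U [HU [ultra Uev]]].
  assert (HN : forall K, U (fun n => K <= INR (N n))).
  { intros K. apply Uev. destruct (nfloor_ex (Rabs K)) as [m Hm]; [apply Rabs_pos|].
    exists (S m). intros n Hn. apply le_INR in Hn. rewrite S_INR in Hn.
    assert (HK := Rle_abs K). assert (Hn2 : INR n <= INR (N n)) by apply Hs. lra. }
  assert (Hinv : filterlim (fun n => / (INR n + 1)) U (locally 0)).
  { apply filterlim_Rabs_le. intros eps Heps. apply Uev.
    destruct (nfloor_ex (/ eps)) as [K HK]; [apply Rlt_le, Rinv_0_lt_compat; lra|].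
    exists K. intros n Hn. apply le_INR in Hn.
    assert (Hi : 0 < / eps) by (apply Rinv_0_lt_compat; lra).
    rewrite Rminus_0_r, Rabs_pos_eq.
    - rewrite <- (Rinv_inv eps). apply Rinv_le_contravar; lra.
    - apply Rlt_le, Rinv_0_lt_compat. lra. }
  assert (HB : 0 <= B) by (specialize (Hl 0%nat); lra).
  destruct (ultralimit_bounded_exists U lam B HU ultra) as [lam' Hlam'].
  { now apply filter_forall. }
  destruct (ultralimit_bounded_exists U l B HU ultra) as [l' Hl'].
  { apply filter_forall. intros n. specialize (Hl n). apply Rabs_le. lra. }
  assert (Hl'0 : l0 <= l').
  { apply (filterlim_Rle (F := U) (fun _ => l0) l); [apply filter_forall; apply Hl|apply filterlim_const|exact Hl']. }
  assert (Lip : forall f : nat -> Z -> R, (forall n i, Rabs (INR (N n) * fwd (f n) i) <= B) ->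
    U (fun n => forall i, Rabs (INR (N n) * (f n (i + 1)%Z - f n i)) <= B)).
  { intros f Hf. apply filter_forall. exact Hf. }
  assert (Hlx := Lip x (fun n i => proj1 (Hpr n i))). assert (Hly := Lip y (fun n i => proj2 (Hpr n i))).
  assert (Hlp := Lip p (fun n i => proj1 (Hdpr n i))). assert (Hlr := Lip r (fun n i => proj2 (Hdpr n i))).
  destruct (node_limit_exists N HN x B B ultra) as [X HX]; [apply filter_forall; intros; apply Hxy|exact Hlx|].
  destruct (node_limit_exists N HN y B B ultra) as [Y HY]; [apply filter_forall; intros; apply Hxy|exact Hly|].
  destruct (node_limit_exists N HN p B B ultra) as [VX HVX]; [apply filter_forall; intros; apply Hpr|exact Hlp|].
  destruct (node_limit_exists N HN r B B ultra) as [VY HVY]; [apply filter_forall; intros; apply Hpr|exact Hlr|].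
  assert (Harea2 : forall n i, INR (N n) * (area_sum n (i + 1)%Z - area_sum n i)
     = / 2 * (y n i * p n i - x n i * r n i)).
  { intros n i. destruct (Harea n) as [_ [H _]]. specialize (H i). unfold fwd at 1 in H. rewrite H.
    unfold p, r, x, y. ring. }
  assert (Henergy2 : forall n i, INR (N n) * (energy_sum n (i + 1)%Z - energy_sum n i)
     = p n i * p n i + r n i * r n i).
  { intros n i. destruct (Henergy n) as [_ [H _]]. specialize (H i). unfold fwd at 1 in H. rewrite H.
    unfold p, r, x, y, N. ring. }
  assert (Hprod : forall u v, Rabs u <= B -> Rabs v <= B -> Rabs (u * v) <= B * B).
  { intros u v Hu Hv. rewrite Rabs_mult. apply Rmult_le_compat; auto using Rabs_pos. }
  destruct (node_limit_exists N HN area_sum 0 (B * B) ultra) as [S HS].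
  { apply filter_forall. intros n. destruct (Harea n) as [H _]. rewrite H, Rabs_R0. lra. }
  { apply filter_forall. intros n i. rewrite Harea2.
    assert (H1 := Hprod _ _ (proj2 (Hxy n i)) (proj1 (Hpr n i))).
    assert (H2 := Hprod _ _ (proj1 (Hxy n i)) (proj2 (Hpr n i))).
    apply Rabs_le_between in H1. apply Rabs_le_between in H2. apply Rabs_le. lra. }
  destruct (node_limit_exists N HN energy_sum 0 (2 * (B * B)) ultra) as [E HE].
  { apply filter_forall. intros n. destruct (Henergy n) as [H _]. rewrite H, Rabs_R0. lra. }
  { apply filter_forall. intros n i. rewrite Henergy2.
    assert (H1 := Hprod _ _ (proj1 (Hpr n i)) (proj1 (Hpr n i))).
    assert (H2 := Hprod _ _ (proj2 (Hpr n i)) (proj2 (Hpr n i))).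
    apply Rabs_le_between in H1. apply Rabs_le_between in H2. apply Rabs_le. lra. }
  set (F := @node_filter U N).
  assert (FF : forall t, ProperFilter (F t)) by (intros t; exact (node_filter_proper N HN t)).
  assert (FF' : forall t, Filter (F t)) by (intros t; apply filter_filter).
  assert (NX : forall t, filterlim (fun z => x (fst z) (snd z)) (F t) (locally (X t))).
  { intros t. exact (filterlim_node_of_lipschitz N HN x X HX B t Hlx). }
  assert (NY : forall t, filterlim (fun z => y (fst z) (snd z)) (F t) (locally (Y t))).
  { intros t. exact (filterlim_node_of_lipschitz N HN y Y HY B t Hly). }
  assert (NP : forall t, filterlim (fun z => p (fst z) (snd z)) (F t) (locally (VX t))).
  { intros t. exact (filterlim_node_of_lipschitz N HN p VX HVX B t Hlp). }
  assert (NR : forall t, filterlim (fun z => r (fst z) (snd z)) (F t) (locally (VY t))).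
  { intros t. exact (filterlim_node_of_lipschitz N HN r VY HVY B t Hlr). }
  assert (Nl : forall t, filterlim (fun z : nat * Z => l (fst z)) (F t) (locally l')).
  { intros t. exact (filterlim_fst_node N HN t l l' Hl'). }
  assert (Nlam : forall t, filterlim (fun z : nat * Z => lam (fst z)) (F t) (locally lam')).
  { intros t. exact (filterlim_fst_node N HN t lam lam' Hlam'). }
  assert (Ng : forall t, filterlim (fun z : nat * Z =>
      l (fst z) * (g (x (fst z) (snd z + 1)%Z) (y (fst z) (snd z + 1)%Z) - lam (fst z)))
      (F t) (locally (l' * (g (X t) (Y t) - lam')))).
  { intros t. apply filterlim_Rmult; [apply Nl|]. apply filterlim_Rminus; [|apply Nlam].
    apply filterlim_unif2; [exact Ug| |].
    - exact (filterlim_shift_node N HN t x (X t) (NX t)).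
    - exact (filterlim_shift_node N HN t y (Y t) (NY t)). }
  assert (Nmid : forall (q : nat -> Z -> R) (Qt t : R),
    filterlim (fun z => q (fst z) (snd z)) (F t) (locally Qt) ->
    filterlim (fun z => (q (fst z) (snd z) + q (fst z) (snd z + 1)%Z) / 2) (F t) (locally Qt)).
  { intros q Qt t Hq. replace Qt with ((Qt + Qt) * / 2) by field.
    apply filterlim_Rmult; [|apply filterlim_const]. apply filterlim_Rplus; [exact Hq|].
    exact (filterlim_shift_node N HN t q Qt Hq). }
  assert (Nerr : forall (u : nat * Z -> R) t,
    (forall z, Rabs (u z) <= / (INR (fst z) + 1)) -> filterlim u (F t) (locally 0)).
  { intros u t Hu. apply filterlim_Rabs_le. intros eps Heps.
    generalize (filterlim_Rabs_lt _ _ eps (filterlim_fst_node N HN t _ 0 Hinv) Heps).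
    apply filter_imp. intros z Hz. rewrite Rminus_0_r in Hz |- *.
    specialize (Hu z). assert (H := Rle_abs (/ (INR (fst z) + 1))). lra. }
  assert (DX : forall t, is_derive X t (VX t)).
  { intros t. apply (is_derive_node_limit N HN x X HX). exact (NP t). }
  assert (DY : forall t, is_derive Y t (VY t)).
  { intros t. apply (is_derive_node_limit N HN y Y HY). exact (NR t). }
  assert (DP : forall t, is_derive VX t (- (l' * (g (X t) (Y t) - lam') * VY t))).
  { intros t. apply (is_derive_node_limit N HN p VX HVX).
    replace (- (l' * (g (X t) (Y t) - lam') * VY t))
      with (0 - l' * (g (X t) (Y t) - lam') * VY t) by ring.
    eapply filterlim_ext; [|apply filterlim_Rminus;
      [apply (Nerr (fun z => INR (N (fst z)) * fwd (p (fst z)) (snd z)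
        + l (fst z) * (g (x (fst z) (snd z + 1)%Z) (y (fst z) (snd z + 1)%Z) - lam (fst z))
          * ((r (fst z) (snd z) + r (fst z) (snd z + 1)%Z) / 2)) t); intros z; apply Hep
      |apply filterlim_Rmult; [apply Ng|apply (Nmid r (VY t) t (NR t))]]].
    intros z. unfold fwd at 1. simpl. ring. }
  assert (DR : forall t, is_derive VY t (l' * (g (X t) (Y t) - lam') * VX t)).
  { intros t. apply (is_derive_node_limit N HN r VY HVY).
    replace (l' * (g (X t) (Y t) - lam') * VX t)
      with (0 + l' * (g (X t) (Y t) - lam') * VX t) by ring.
    eapply filterlim_ext; [|apply filterlim_Rplus;
      [apply (Nerr (fun z => INR (N (fst z)) * fwd (r (fst z)) (snd z)
        - l (fst z) * (g (x (fst z) (snd z + 1)%Z) (y (fst z) (snd z + 1)%Z) - lam (fst z))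
          * ((p (fst z) (snd z) + p (fst z) (snd z + 1)%Z) / 2)) t); intros z; apply Her
      |apply filterlim_Rmult; [apply Ng|apply (Nmid p (VX t) t (NP t))]]].
    intros z. unfold fwd at 1. simpl. ring. }
  assert (DS : forall t, is_derive S t (/ 2 * (Y t * VX t - X t * VY t))).
  { intros t. apply (is_derive_node_limit N HN area_sum S HS).
    eapply filterlim_ext; [intros z; symmetry; apply Harea2|].
    apply filterlim_Rmult; [apply filterlim_const|].
    apply filterlim_Rminus; apply filterlim_Rmult; auto. }
  assert (DE : forall t, is_derive E t (VX t * VX t + VY t * VY t)).
  { intros t. apply (is_derive_node_limit N HN energy_sum E HE).
    eapply filterlim_ext; [intros z; symmetry; apply Henergy2|].
    apply filterlim_Rplus; apply filterlim_Rmult; auto. }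
  assert (Hper : forall (f : nat -> Z -> R) (phi : R -> R),
    (forall n, periodic (N n) (f n)) ->
    (forall t, filterlim (fun n => f n (node N t n)) U (locally (phi t))) -> forall t, phi (t + 1) = phi t).
  { intros f phi Pf Hphi t.
    apply (filterlim_Runique (F := U) (fun n => f n (node N t n))); [|apply Hphi].
    eapply filterlim_ext; [|apply (Hphi (t + 1))]. intros n. simpl. rewrite node_succ. apply Pf. }
  assert (Hends : forall (f : nat -> Z -> R) (phi : R -> R) (v : nat -> R) w,
    (forall n, f n 0%Z = 0 /\ f n (Z.of_nat (N n)) = v n) -> filterlim v U (locally w) ->
    (forall t, filterlim (fun n => f n (node N t n)) U (locally (phi t))) -> phi 1 - phi 0 = w).
  { intros f phi v w Hf Hv Hphi.
    replace (phi 0) with 0.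
    - rewrite Rminus_0_r. apply (filterlim_Runique (F := U) v); [|exact Hv].
      eapply filterlim_ext; [|apply (Hphi 1)]. intros n. simpl. replace 1 with (0 + 1) by ring.
      rewrite node_succ, node_0. apply Hf.
    - apply (filterlim_Runique (F := U) (fun _ => 0)); [apply filterlim_const|].
      eapply filterlim_ext; [|apply (Hphi 0)]. intros n. simpl. rewrite node_0. apply Hf. }
  assert (ES : S 1 - S 0 = a).
  { apply (Hends area_sum S (fun _ => a)); [|apply filterlim_const|exact HS].
    intros n. destruct (Harea n) as [H1 [_ H2]]. split; [exact H1|]. rewrite H2, zsum_scal. apply (Hs n). }
  assert (EE : E 1 - E 0 = l' * l').
  { apply (Hends energy_sum E (fun n => l n * l n)); [|now apply filterlim_Rmult|exact HE].
    intros n. destruct (Henergy n) as [H1 [_ H2]]. split; [exact H1|]. rewrite H2, zsum_scal. apply (Hs n). }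
  (* Acceleration is orthogonal to velocity, so the speed is constant; the limit of the energies
     identifies its square as the square of the very [l'] that occurs in the equation. *)
  assert (Hspeed : forall t, VX t * VX t + VY t * VY t = l' * l').
  { assert (Hd0 : forall t, is_derive (fun t => VX t * VX t + VY t * VY t) t 0).
    { intros t. set (k := l' * (g (X t) (Y t) - lam')).
      replace 0 with ((- (k * VY t) * VX t + VX t * - (k * VY t)) + ((k * VX t) * VY t + VY t * (k * VX t))) by ring.
      apply is_derive_Rplus; apply is_derive_Rmult; unfold k; auto. }
    assert (Hconst : forall t, VX t * VX t + VY t * VY t = VX 0 * VX 0 + VY 0 * VY 0).
    { intros t. destruct (mean_value _ _ 0 t Hd0) as [z [_ Hz]]. lra. }
    destruct (mean_value E _ 0 1 DE) as [z [_ Hz]]. rewrite EE, Hconst in Hz.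
    intros t. rewrite Hconst. lra. }
  exists X, Y, VX, VY, lam', l'.
  split; [lra|].
  split; [apply (Hper x X); [intros n; apply Hs|exact HX]|].
  split; [apply (Hper y Y); [intros n; apply Hs|exact HY]|].
  repeat (split; [assumption|]).
  rewrite <- ES.
  apply (is_RInt_derive (V := R_CompleteNormedModule) S); intros t _; [apply DS|].
  assert (CX := is_derive_continuous_R _ _ _ (DX t)). assert (CY := is_derive_continuous_R _ _ _ (DY t)).
  assert (CP := is_derive_continuous_R _ _ _ (DP t)). assert (CR := is_derive_continuous_R _ _ _ (DR t)).
  apply continuous_Rmult; [apply continuous_const|].
  apply continuous_Rminus; now apply continuous_Rmult.
Qed.

(** * From the loop back to the curvature equation *)

Lemma holder_unif2 (alpha : R) (H : R * R -> R) :
  0 < alpha -> holder_C0a alpha H -> unif2 (fun x y => H (x, y)).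
Proof.
  intros Ha [_ [C HC]] eps Heps.
  set (K := Rabs C + 1). assert (HK : 0 < K) by (unfold K; assert (H0 := Rabs_pos C); lra).
  set (z := eps / K). assert (Hz : 0 < z) by (apply Rdiv_lt_0_compat; lra).
  (* Inverts the modulus: [K * Rpower d alpha = eps]. Coordinates within [d / 2] keep the distance
     at most [d]. *)
  set (d := Rpower z (/ alpha)). assert (Hd : 0 < d) by apply exp_pos.
  exists (d / 2). split; [lra|]. intros x y x' y' Hx Hy.
  (* Equal points are treated apart because [Rpower] is positive even at 0. *)
  destruct (classic ((x, y) = (x', y'))) as [E|Hne].
  { rewrite E, Rminus_eq_0, Rabs_R0. lra. }
  assert (HCp := HC (x, y) (x', y') Hne). simpl in HCp.
  set (n := norm2 (x - x', y - y')) in *.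
  assert (Hn0 : 0 < n).
  { apply sqrt_lt_R0. cbn [fst snd].
    assert (A1 := pow2_ge_0 (x - x')). assert (A2 := pow2_ge_0 (y - y')).
    destruct (Req_dec x x') as [E1|E1].
    - destruct (Req_dec y y') as [E2|E2]; [subst; now elim Hne|].
      assert (0 < (y - y') ^ 2) by (apply pow2_gt_0; lra). lra.
    - assert (0 < (x - x') ^ 2) by (apply pow2_gt_0; lra). lra. }
  assert (Hn : n <= d).
  { unfold n, norm2. simpl fst. simpl snd. rewrite <- (sqrt_pow2 d) by lra. apply sqrt_le_1_alt.
    assert (H1 : (x - x') ^ 2 <= (d / 2) ^ 2) by (apply pow_maj_Rabs; exact Hx).
    assert (H2 : (y - y') ^ 2 <= (d / 2) ^ 2) by (apply pow_maj_Rabs; exact Hy).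
    assert (H3 := pow2_ge_0 d).
    replace ((d / 2) ^ 2) with (d ^ 2 / 4) in H1, H2 by field. lra. }
  assert (Hp : Rpower n alpha <= z).
  { replace z with (Rpower d alpha).
    - apply Rle_Rpower_l; lra.
    - unfold d. rewrite Rpower_mult, Rinv_l by lra. now apply Rpower_1. }
  eapply Rle_trans; [exact HCp|].
  assert (Hpp : 0 < Rpower n alpha) by apply exp_pos.
  apply Rle_trans with (K * z); [|right; unfold z; field; lra].
  apply Rle_trans with (K * Rpower n alpha).
  - apply Rmult_le_compat_r; [lra|]. unfold K. assert (H0 := Rle_abs C). lra.
  - apply Rmult_le_compat_l; lra.
Qed.

Theorem theorem1p1p1 (H : R * R -> R) (alpha : R) :
  0 < alpha < 1 ->
  holder_C0a alpha H ->
  Z2_periodic H ->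
  (exists c, c < 2 * sqrt 2 /\ forall p, Rabs (H p - mean_H H) <= c) ->
  forall tau : R, tau <> 0 ->
    exists (u : R -> R * R) (lambda : R),
      C2_curve u /\
      (forall t, (du1 u t, du2 u t) <> (0, 0)) /\
      exists T : R, 0 < T /\
        (forall t, u (t + T) = u t) /\
        area T u = tau /\
        (forall t, curvature u t = H (u t) - lambda).
Proof.
  intros Halpha Hholder Hper [c0 [Hc0 HcH]] tau Htau.
  assert (Hs2 : 0 < sqrt 2) by (apply sqrt_lt_R0; lra).
  (* The midpoint is positive even for constant [H], where [c0] may be 0, and still below
     [2 sqrt 2]. *)
  set (c := (c0 + 2 * sqrt 2) / 2).
  assert (Hc0p : 0 <= c0) by (eapply Rle_trans; [apply Rabs_pos|apply (HcH (0, 0))]).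
  set (m := mean_H H). set (g := fun x y => H (x, y) - m).
  assert (UH := holder_unif2 alpha H (proj1 Halpha) Hholder).
  assert (Ug : unif2 g).
  { intros eps Heps. destruct (UH eps Heps) as [d [Hd Hdd]]. exists d. split; [exact Hd|].
    intros x y x' y' Hx Hy. unfold g.
    replace (H (x, y) - m - (H (x', y') - m)) with (H (x, y) - H (x', y')) by ring. now apply Hdd. }
  assert (CH : forall x y, continuous (fun y => H (x, y)) y).
  { intros x y. exact (unif2_continuous_r (fun x y => H (x, y)) x y UH). }
  destruct (magnetic_loop_exists g c tau Ug) as [X [Y [VX [VY [lam [l HXY]]]]]].
  - intros x y. unfold g. f_equal. rewrite <- (Hper (x, y) 1%Z 0%Z). simpl. now rewrite Rplus_0_r.
  - intros x y. unfold g. f_equal. rewrite <- (Hper (x, y) 0%Z 1%Z). simpl. now rewrite Rplus_0_r.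
  - intros x y. eapply Rle_trans; [apply HcH|]. unfold c. lra.
  - assert (Hconst : forall k : R, RInt (fun _ : R => k) 0 1 = k).
    { intros k. rewrite RInt_const. unfold scal; simpl; unfold mult; simpl. ring. }
    transitivity (RInt (fun x => RInt (fun y => H (x, y)) 0 1 - m) 0 1).
    + apply RInt_ext. intros x _. unfold g.
      rewrite RInt_Rminus; [|apply CH|intros; apply continuous_const]. now rewrite Hconst.
    + rewrite RInt_Rminus; [| |intros; apply continuous_const].
      * rewrite Hconst. unfold m, mean_H. apply Rminus_eq_0.
      * intros x. exact (unif2_continuous_l _ x 0 (unif2_partial_mean _ UH)).
  - unfold c. lra.
  - exact Htau.
  - destruct HXY as [Hl [PX [PY [DX [DY [DP [DR [Hspeed Harea]]]]]]]].
    set (u := fun t => (X t, Y t)).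
    assert (E1 : du1 u = VX).
    { apply functional_extensionality. intros t. apply is_derive_unique, DX. }
    assert (E2 : du2 u = VY).
    { apply functional_extensionality. intros t. apply is_derive_unique, DY. }
    set (k := fun t => l * (g (X t) (Y t) - lam)).
    assert (E3 : ddu1 u = fun t => - (k t * VY t)).
    { apply functional_extensionality. intros t. unfold ddu1. rewrite E1. apply is_derive_unique, DP. }
    assert (E4 : ddu2 u = fun t => k t * VX t).
    { apply functional_extensionality. intros t. unfold ddu2. rewrite E2. apply is_derive_unique, DR. }
    assert (CX := fun t => is_derive_continuous_R _ _ _ (DX t)).
    assert (CY := fun t => is_derive_continuous_R _ _ _ (DY t)).
    assert (CP := fun t => is_derive_continuous_R _ _ _ (DP t)).
    assert (CR := fun t => is_derive_continuous_R _ _ _ (DR t)).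
    assert (Ck : forall t, continuous k t).
    { intros t. apply continuous_Rmult; [apply continuous_const|].
      apply continuous_Rminus; [|apply continuous_const].
      exact (filterlim_unif2 g X Y _ _ Ug (CX t) (CY t)). }
    exists u, (m + lam). split; [split|split].
    + intros t. split; [|split].
      * exists (VX t). apply DX.
      * change (ex_derive (du1 u) t). rewrite E1. eexists. apply DP.
      * change (continuous (ddu1 u) t). rewrite E3.
        apply (continuous_opp (V := R_NormedModule) (fun t => k t * VY t)). now apply continuous_Rmult.
    + intros t. split; [|split].
      * exists (VY t). apply DY.
      * change (ex_derive (du2 u) t). rewrite E2. eexists. apply DR.
      * change (continuous (ddu2 u) t). rewrite E4. now apply continuous_Rmult.
    + intros t E. rewrite E1, E2 in E. injection E as EP ER.
      specialize (Hspeed t). rewrite EP, ER in Hspeed. nra.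
    + exists 1. split; [lra|]. split; [intros t; unfold u; now rewrite PX, PY|]. split.
      * unfold area. rewrite E1, E2.
        rewrite <- (is_RInt_unique _ _ _ _ Harea). rewrite <- RInt_Rscal.
        { apply RInt_ext. intros t _. unfold dot, rot, u. simpl. ring. }
        intros t. unfold dot, rot, u. simpl.
        apply continuous_Rplus; apply continuous_Rmult; auto.
        apply (continuous_opp (V := R_NormedModule) VY). apply CR.
      * intros t. unfold curvature. rewrite E1, E2, E3, E4. unfold dot, rot, norm2. cbn [fst snd].
        (* With speed [l] the curvature is [k l^2 / l^3 = k / l = g - lam]. *)
        replace (VX t ^ 2 + VY t ^ 2) with (l ^ 2) by (specialize (Hspeed t); nra).
        rewrite sqrt_pow2 by lra.
        replace (- VY t * - (k t * VY t) + VX t * (k t * VX t)) with (k t * (VX t * VX t + VY t * VY t)) by ring.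
        rewrite Hspeed. unfold k, g, u. field. lra.
Qed.
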